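(* Let $s>2$ be a prime power, $n\ge2$ and $1\le k<s$. Take column $X_1^2+X_2$ of $Q_1(X_1,\dots,X_n)$ as a branching column. The row juxtaposition of any $k$ fractions forms an $SSD(ks^{n-1},s^m)$ with $m=(s^n-s)/(s-1)$ after removing the branching column. It has overall $A_2=(s^n-s)(s-k)/(2k)$ and is optimal under GMA. Furthermore, there are no fully aliased columns for $1<k<s$. (i) For $s$ odd, there are $s(s^n-s^2+s-1)/2$ pairs of nonorthogonal columns: $s(s-1)/2$ pairs with projected $A_2=(s-k)/k$ and $s(s^n-s^2)/2$ pairs with projected $A_2=(s-k)/(ks)$. (ii) For $s$ even, there are at most $(s-1)(s^n-s^2+s)/2$ pairs of nonorthogonal columns: $s(s-1)/2$ pairs with projected $A_2=(s-k)/k$ and at most $(s-1)(s^n-s^2)/2$ pairs with projected $A_2\le 1$. (iii) For $s=4$ and $k=2$, there are $(4^n-4)/2$ pairs of nonorthogonal columns with projected $A_2=1$; for $s=4$ and $k=3$, there are $6$ pairs of nonorthogonal columns with projected $A_2=1/3$ and $3(4^n-16)/2$ pairs with projected $A_2=1/9$.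
   Context: Designs: $SSD(N,s^m)$ denotes an $N\times m$ matrix $D=[x_{ik}]$ with entries in a set of $s$ symbols (here the finite field $F_s$ with $s$ elements), which is balanced: in every column each symbol appears exactly $N/s$ times. Generalized wordlength pattern: choose orthonormal contrasts on the symbol set, i.e. complex-valued functions $c_1,\dots,c_{s-1}$ on the symbols with $\sum_x c_a(x)=0$ and $\sum_x c_a(x)\overline{c_b(x)}=s$ if $a=b$ and $0$ otherwise. For $j=1,\dots,m$, $$A_j(D)=N^{-2}\sum_{K\subseteq\{1,\dots,m\},\,|K|=j}\ \sum_{(a_k)_{k\in K}\in\{1,\dots,s-1\}^K}\Big|\sum_{i=1}^N\prod_{k\in K}c_{a_k}(x_{ik})\Big|^2 ,$$ independently of the choice of contrasts. The overall $A_2$ is $A_2(D)$; the projected $A_2$ value of a pair of columns is $A_2$ of the two-column design they form. $D$ is optimal under GMA (generalized minimum aberration) if there is no $SSD(N,s^m)$ $D'$ and index $r$ with $A_j(D')=A_j(D)$ for all $j<r$ and $A_r(D')<A_r(D)$. Polynomial columns: a function $f(X_1,\dots,X_n)$ on $F_s^n$ gives a column of length $s^n$, rows being indexed by the points of $F_s^n$. $H(X_2,\dots,X_n)$ is the set of nonzero linear forms $c_2X_2+\cdots+c_nX_n$ ($c_i\in F_s$) whose last nonzero coefficient is $1$, and $Q_1(X_1,\dots,X_n)=\{X_1\}\cup\{X_1^2+aX_1+h: a\in F_s,\ h\in H(X_2,\dots,X_n)\}$, regarded as the $s^n\times(s^n-1)/(s-1)$ design with these columns. Fractions: given a branching column,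 the $s^n$ rows are divided into $s$ fractions of $s^{n-1}$ rows each, according to the level of the branching column. The row juxtaposition of $k$ fractions consists of all rows whose level in the branching column lies in a given $k$-subset of $F_s$. Two columns of a design with $N$ runs are orthogonal if every one of the $s^2$ level combinations occurs equally often (projected $A_2=0$), and fully aliased if the pair has only $s$ distinct level combinations, each occurring $N/s$ times (projected $A_2=s-1$). *)

(* Defs.v *)
From HB Require Import structures.
From mathcomp Require Import all_boot all_order all_algebra.

Set Implicit Arguments.
Unset Strict Implicit.
Unset Printing Implicit Defensive.

Import Order.TTheory GRing.Theory Num.Theory.
Local Open Scope ring_scope.

(* A finite field F carries the s := #|F| symbols (s is then
   an arbitrary prime power), and a design with N runs and m columns is a
   matrix in 'M[F]_(N, m).  The contrasts take their values in an arbitrary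
   C : numClosedFieldType, e.g. the complex numbers R[i] over R : realType. *)

Definition balanced (F : finFieldType) (N m : nat) (D : 'M[F]_(N, m)) : bool :=
  [forall k : 'I_m, forall u : F,
     #|[set i : 'I_N | D i k == u]| == (N %/ #|F|)%N].

(* The dimensions of D are compared propositionally with N and m because the
   designs built below have dimensions of the form #|A|. *)
Definition is_SSD (F : finFieldType) (N m N' m' : nat) (D : 'M[F]_(N', m')) :
    Prop :=
  [/\ N' = N, m' = m & balanced D].

Definition orthonormal_contrasts (F : finFieldType) (C : numClosedFieldType)
    (c : 'I_(#|F|.-1) -> F -> C) : Prop :=
  (forall a, \sum_(x : F) c a x = 0) /\
  (forall a b, \sum_(x : F) c a x * (c b x)^* = if a == b then #|F|%:R else 0).

Definition gwp (F : finFieldType) (C : numClosedFieldType)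
    (c : 'I_(#|F|.-1) -> F -> C) (j N m : nat) (D : 'M[F]_(N, m)) : C :=
  N%:R ^- 2 *
  \sum_(K : {set 'I_m} | #|K| == j)
    \sum_(a : {ffun {k : 'I_m | k \in K} -> 'I_(#|F|.-1)})
      `| \sum_(i < N) \prod_(k : {k : 'I_m | k \in K}) c (a k) (D i (val k)) |
      ^+ 2.

(* All the competitors D' are evaluated with the contrasts used for D; the
   values of gwp do not depend on this choice. *)
Definition GMA_optimal (F : finFieldType) (C : numClosedFieldType)
    (c : 'I_(#|F|.-1) -> F -> C) (N m : nat) (D : 'M[F]_(N, m)) : Prop :=
  ~ exists (D' : 'M[F]_(N, m)) (r : nat),
      [/\ is_SSD N m D',
          (1 <= r <= m)%N,
          (forall j : nat, (1 <= j < r)%N -> gwp c j D' = gwp c j D) &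
          gwp c r D' < gwp c r D].

Definition pair_design (F : finFieldType) (N m : nat) (D : 'M[F]_(N, m))
    (p : 'I_m * 'I_m) : 'M[F]_(N, 2) :=
  \matrix_(i < N, l < 2) D i (if l == 0 then p.1 else p.2).

Definition projected_A2 (F : finFieldType) (C : numClosedFieldType)
    (c : 'I_(#|F|.-1) -> F -> C) (N m : nat) (D : 'M[F]_(N, m))
    (p : 'I_m * 'I_m) : C :=
  gwp c 2 (pair_design D p).

Definition combination_count (F : finFieldType) (N m : nat)
    (D : 'M[F]_(N, m)) (p : 'I_m * 'I_m) (uv : F * F) : nat :=
  #|[set i : 'I_N | (D i p.1 == uv.1) && (D i p.2 == uv.2)]|.

Definition orthogonal_pair (F : finFieldType) (N m : nat) (D : 'M[F]_(N, m))
    (p : 'I_m * 'I_m) : bool :=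
  [forall uv : F * F, forall uv' : F * F,
     combination_count D p uv == combination_count D p uv'].

Definition fully_aliased_pair (F : finFieldType) (N m : nat)
    (D : 'M[F]_(N, m)) (p : 'I_m * 'I_m) : bool :=
  (#|[set uv : F * F | (0 < combination_count D p uv)%N]| == #|F|) &&
  [forall uv : F * F, (0 < combination_count D p uv)%N ==>
     (combination_count D p uv == (N %/ #|F|)%N)].

(* Unordered pairs of distinct columns are encoded by increasing pairs. *)
Definition column_pairs (m : nat) : {set 'I_m * 'I_m} :=
  [set p : 'I_m * 'I_m | (p.1 < p.2)%N].

Definition nonorthogonal_pairs (F : finFieldType) (N m : nat)
    (D : 'M[F]_(N, m)) : {set 'I_m * 'I_m} :=
  [set p in column_pairs m | ~~ orthogonal_pair D p].

(* There are n.+2 variables: X_1 is coordinate 0 of a point, X_2 is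
   coordinate 1, and so on.  Polynomials are considered as functions; when
   #|F| > 2, distinct members of Q1 are distinct functions. *)
Definition X1 (F : finFieldType) (n : nat) : {ffun 'rV[F]_n.+2 -> F} :=
  [ffun x : 'rV[F]_n.+2 => x 0 0].

Definition linear_form (F : finFieldType) (n : nat) (d : 'rV[F]_n.+2) :
    {ffun 'rV[F]_n.+2 -> F} :=
  [ffun x : 'rV[F]_n.+2 => \sum_(i < n.+2) d 0 i * x 0 i].

(* d 0 0 == 0 discards the variable X_1; the index i is then nonzero, and it
   is the position of the last nonzero coefficient. *)
Definition forms_H (F : finFieldType) (n : nat) :
    {set {ffun 'rV[F]_n.+2 -> F}} :=
  [set linear_form d | d in
     [set d : 'rV[F]_n.+2 | (d 0 0 == 0) &&
        [exists i : 'I_n.+2, (d 0 i == 1) &&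
           [forall j : 'I_n.+2, (i < j)%N ==> (d 0 j == 0)]]]].

Definition quadratic_column (F : finFieldType) (n : nat) (a : F)
    (h : {ffun 'rV[F]_n.+2 -> F}) : {ffun 'rV[F]_n.+2 -> F} :=
  [ffun x : 'rV[F]_n.+2 => x 0 0 ^+ 2 + a * x 0 0 + h x].

Definition Q1 (F : finFieldType) (n : nat) : {set {ffun 'rV[F]_n.+2 -> F}} :=
  X1 F n |: [set quadratic_column a h | a in [set: F], h in forms_H F n].

Definition branching (F : finFieldType) (n : nat) :
    {ffun 'rV[F]_n.+2 -> F} :=
  [ffun x : 'rV[F]_n.+2 => x 0 0 ^+ 2 + x 0 1].

Definition design_of (F : finFieldType) (n : nat) (rows : {set 'rV[F]_n.+2})
    (cols : {set {ffun 'rV[F]_n.+2 -> F}}) : 'M[F]_(#|rows|, #|cols|) :=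
  \matrix_(i < #|rows|, j < #|cols|)
    (enum_val j : {ffun 'rV[F]_n.+2 -> F}) (enum_val i).

(* Juxtaposition of the fractions whose branching level lies in S, without
   the branching column. *)
Definition juxtaposition (F : finFieldType) (n : nat) (S : {set F}) :=
  design_of [set x : 'rV[F]_n.+2 | branching F n x \in S]
            (Q1 F n :\ branching F n).

(* Main.v *)
Require Import Defs.
From HB Require Import structures.
From mathcomp Require Import all_boot all_order all_algebra.
From mathcomp Require Import all_fingroup all_solvable finfield.
From mathcomp Require Import ring zify.

Set Implicit Arguments.
Unset Strict Implicit.
Unset Printing Implicit Defensive.

Import Order.TTheory GRing.Theory Num.Theory.
Local Open Scope ring_scope.

(** By orthonormality of the contrasts, the j-th wordlength of a design is the sum,
    over all ordered pairs of rows, of a quantity that depends only on the number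
    of columns in which the two rows agree ([gwp_agreement]).  For balanced
    designs the total agreement is fixed, and the second wordlength measures how
    far the agreements of distinct rows are from two consecutive integers l and
    l + 1.  Hence a balanced design in which all these agreements are l or l + 1
    has the least second wordlength, and any design reaching it has the same
    number of pairs of rows with each agreement, thus the same wordlengths
    ([near_constant_GMA_optimal]).  Any two points of F^(n+2) agree in the same
    number of columns of Q1 ([card_Q1_agree]); removing the branching column
    lowers this number by one exactly when the two points have the same branching
    level.  This gives the optimality and the overall A2.

    The projected A2 of two columns is determined by the number of pairs of rows on
    which both agree, and it vanishes exactly for orthogonal columns
    ([orthogonal_pair_A2]).  Translating the points along coordinates while
    preserving the branching level shows that two distinct columns are
    orthogonal unless ([column_pair_cases])
    - both belong to the pencil formed by X_1 and the X_1^2 + a X_1 + X_2 with a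
      nonzero: they then determine X_1 and the branching level, which gives
      (s - k) / k; or
    - they form a twisted pair X_1^2 + a X_1 + h, X_1^2 + (a + b e) X_1 + h + b X_2
      with b nonzero and h different from X_2.
    For a twisted pair, the difference of the columns is -b times a function of
    X_1 = t and of the branching level z, namely z - t^2 + e t, and the projected
    A2 counts the solutions of z - z' = (t - t') (t + t' - e) with z, z' in S.  For
    s odd this is a count of solutions of p r = z - z', independent of e
    ([twist_odd]).  For s even, t + t' = t - t', and the count is s times that of
    the solutions p of p (p - e) = z - z': exactly one if e = 0, which makes the
    columns orthogonal, and at most two otherwise.  For s = 4 and e nonzero,
    there are two solutions if z - z' is 0 or e^2, and none otherwise ([twist4]).
    Counting ordered pairs of the two kinds gives the numbers of pairs. *)

(** * Wordlengths as sums over pairs of rows *)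

Lemma mulmx1C_cast (K : comPzRingType) (m n : nat) (A : 'M[K]_(m, n))
    (B : 'M[K]_(n, m)) : m = n -> A *m B = 1%:M -> B *m A = 1%:M.
Proof. by move=> mn; move: A B; rewrite mn => A B; exact: mulmx1C. Qed.

(** The constant 1 and the contrasts form, up to scaling, a unitary matrix; its
    columns are orthogonal as well as its rows. *)
Lemma contrasts_dual (F : finFieldType) (C : numClosedFieldType)
    (c : 'I_(#|F|.-1) -> F -> C) (x y : F) : orthonormal_contrasts c ->
  \sum_a c a x * (c a y)^* = #|F|%:R * (x == y)%:R - 1.
Proof.
move=> [c0 c1].
have F0 : (0 < #|F|)%N by apply/card_gt0P; exists 0.
have sE : (1 + #|F|.-1)%N = #|F| by rewrite add1n prednK.
have s0 : #|F|%:R != 0 :> C by rewrite pnatr_eq0 -lt0n.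
pose A : 'M[C]_(1 + #|F|.-1, #|F|) :=
  col_mx (const_mx 1) (\matrix_(a, j) c a (enum_val j)).
pose B : 'M[C]_(#|F|, 1 + #|F|.-1) :=
  #|F|%:R^-1 *: row_mx (const_mx 1) (\matrix_(j, a) (c a (enum_val j))^*).
have AB : A *m B = 1%:M.
  rewrite /A /B -scalemxAr mul_col_row scalar_mx_block scale_block_mx.
  congr block_mx; apply/matrixP => i j; rewrite !mxE.
  - rewrite !ord1 (eq_bigr (fun=> 1)) => [|l _]; last by rewrite !mxE mul1r.
    by rewrite sumr_const card_ord mulVf.
  - rewrite (eq_bigr (fun l => (c j (enum_val l))^*)) => [|l _]; last first.
      by rewrite !mxE mul1r.
    rewrite -(big_enum_val (A := F) (fun x => (c j x)^*)) /=.
    by rewrite -rmorph_sum c0 rmorph0 mulr0.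
  - rewrite (eq_bigr (fun l => c i (enum_val l))) => [|l _]; last first.
      by rewrite !mxE mulr1.
    by rewrite -(big_enum_val (A := F) (fun x => c i x)) /= c0 mulr0.
  - rewrite (eq_bigr (fun l => c i (enum_val l) * (c j (enum_val l))^*));
      last by move=> l _; rewrite !mxE.
    rewrite -(big_enum_val (A := F) (fun x => c i x * (c j x)^*)) /= c1.
    by case: (i == j); rewrite ?mulr0 ?mulVf.
have /matrixP/(_ (enum_rank y) (enum_rank x)) := mulmx1C_cast sE AB.
rewrite mxE big_split_ord big_ord1 /A /B mxE row_mxEl col_mxEu 2!mxE !mulr1.
rewrite (eq_bigr (fun a => #|F|%:R^-1 * (c a x * (c a y)^*))); last first.
  move=> a _; rewrite mxE row_mxEr col_mxEd 2!mxE !enum_rankK.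
  by rewrite mulrC mulrCA.
rewrite mxE.
rewrite -mulr_sumr (inj_eq enum_rank_inj) eq_sym => /(congr1 ( *%R #|F|%:R)).
by rewrite mulrDr mulrA mulfV // mul1r => <-; rewrite addrAC subrr add0r.
Qed.

(** Expanding the squared modulus into a sum over pairs of rows eliminates the
    contrasts. *)
Lemma gwp_rows (F : finFieldType) (C : numClosedFieldType)
    (c : 'I_(#|F|.-1) -> F -> C) (j N m : nat) (D : 'M[F]_(N, m)) :
  orthonormal_contrasts c ->
  gwp c j D = N%:R ^- 2 * \sum_i \sum_i' \sum_(K : {set 'I_m} | #|K| == j)
    \prod_(k in K) (#|F|%:R * (D i k == D i' k)%:R - 1).
Proof.
move=> hc; rewrite /gwp; congr (_ * _).
under [RHS]eq_bigr do rewrite exchange_big /=.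
rewrite [RHS]exchange_big /=; apply: eq_bigr => K _.
transitivity (\sum_(a : {ffun {k : 'I_m | k \in K} -> 'I_(#|F|.-1)})
   \sum_i \sum_i' \prod_(k : {k : 'I_m | k \in K})
       (c (a k) (D i (val k)) * (c (a k) (D i' (val k)))^*)).
  apply: eq_bigr => a _; rewrite normCK rmorph_sum mulr_suml.
  apply: eq_bigr => i _; rewrite mulr_sumr; apply: eq_bigr => i' _.
  by rewrite rmorph_prod -big_split.
rewrite exchange_big; apply: eq_bigr => i _.
rewrite exchange_big; apply: eq_bigr => i' _.
rewrite -(bigA_distr_bigA (fun (k : {k : 'I_m | k \in K}) a =>
   c a (D i (val k)) * (c a (D i' (val k)))^*)).
by rewrite [RHS]big_sub; apply: eq_bigr => k _; rewrite contrasts_dual.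
Qed.

Lemma coef_prod_lin (C : comNzRingType) (m j : nat) (z : 'I_m -> C) :
  (\prod_k (1 + z k *: 'X))`_j = \sum_(K : {set 'I_m} | #|K| == j)
    \prod_(k in K) z k.
Proof.
under eq_bigr do rewrite addrC.
rewrite bigA_distr coef_sum [RHS]big_mkcond /=.
apply: eq_big => [K|K _]; first by rewrite inE.
rewrite (eq_bigr (fun k => if k \in K then z k *: 'X else 1)) //.
rewrite -big_mkcond /= scaler_prod prodr_const coefZ coefXn eq_sym.
by case: eqP => _; rewrite ?mulr1 ?mulr0.
Qed.

(** The first two Newton identities, read off the product of the 1 + z_k X. *)
Lemma coefs_prod_lin (C : comNzRingType) (m : nat) (z : 'I_m -> C) :
  let P := \prod_k (1 + z k *: 'X) in
  P`_1 = \sum_k z k /\ P`_2 *+ 2 = (\sum_k z k) ^+ 2 - \sum_k z k ^+ 2.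
Proof.
move=> P; suff [] : [/\ P`_0 = 1, P`_1 = \sum_k z k &
    P`_2 *+ 2 = (\sum_k z k) ^+ 2 - \sum_k z k ^+ 2] by [].
rewrite {}/P; elim/big_ind3: _ => [|p x y q x' y' [p0 p1 p2] [q0 q1 q2]|k _].
- by rewrite !coef1; split=> //=; rewrite mul0rn expr0n subr0.
- split; first by rewrite coefM big_ord1 subnn p0 q0 mulr1.
    by rewrite coefM !big_ord_recl big_ord0 /= p0 p1 q0 q1; ring.
  rewrite coefM !big_ord_recl big_ord0 /= /bump /= !addn1 p0 q0 p1 q1.
  by ring: p2 q2.
- rewrite !coefD !coef1 !coefZ !coefX /= mulr0 mulr1 add0r !addr0 subrr.
  by rewrite mul0rn.
Qed.

(** * Row agreements and generalized minimum aberration *)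

(** The number of columns in which two rows carry the same symbol. *)
Definition agreement (T : eqType) (N m : nat) (D : 'M[T]_(N, m)) (i i' : 'I_N) : nat :=
  #|[set k | D i k == D i' k]|.

Lemma agreement_diag (T : eqType) (N m : nat) (D : 'M[T]_(N, m)) i :
  agreement D i i = m.
Proof.
rewrite /agreement -[RHS]card_ord -cardsT; apply: eq_card => k.
by rewrite !inE eqxx.
Qed.

Lemma sum_agreement (K : pzSemiRingType) (T : eqType) (N m : nat)
    (D : 'M[T]_(N, m)) i i' :
  \sum_k (D i k == D i' k)%:R = (agreement D i i')%:R :> K.
Proof.
rewrite -natr_sum /agreement -sum1_card [in RHS]big_mkcond /=; congr _%:R.
by apply: eq_bigr => k _; rewrite inE; case: eqP.
Qed.

(** The generating polynomial whose j-th coefficient is the contribution to the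
    j-th wordlength of two rows that agree in d of the m columns. *)
Definition agreement_poly (C : comNzRingType) (s : C) (m d : nat) : {poly C} :=
  (1 + (s - 1) *: 'X) ^+ d * (1 - 'X) ^+ (m - d).

Lemma gwp_agreement (F : finFieldType) (C : numClosedFieldType)
    (c : 'I_(#|F|.-1) -> F -> C) (j N m : nat) (D : 'M[F]_(N, m)) :
  orthonormal_contrasts c ->
  gwp c j D = N%:R ^- 2 * \sum_i \sum_i'
    (agreement_poly (#|F|%:R : C) m (agreement D i i'))`_j.
Proof.
move=> hc; rewrite gwp_rows //; congr (_ * _).
apply: eq_bigr => i _; apply: eq_bigr => i' _.
rewrite -coef_prod_lin; congr (_`_ _).
rewrite (bigID (mem [set k | D i k == D i' k])) /=.
set A := [set k | _]; set p1 := bigop _ _ _; set p2 := bigop _ _ _.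
have -> : p1 = (1 + (#|F|%:R - 1) *: 'X) ^+ #|A|.
  rewrite /p1 -prodr_const; apply: eq_bigr => k; rewrite inE => /eqP->.
  by rewrite eqxx mulr1.
have -> // : p2 = (1 - 'X) ^+ (m - #|A|).
have -> : (m - #|A|)%N = #|~: A|.
  by apply: (@addnI #|A|); rewrite cardsC card_ord subnKC // -[leqRHS]card_ord max_card.
rewrite /p2 -prodr_const; apply: eq_big => [k|k]; first by rewrite !inE.
by rewrite inE => /negPf->; rewrite mulr0 sub0r scaleN1r.
Qed.

Lemma gwp1_agreement (F : finFieldType) (C : numClosedFieldType)
    (c : 'I_(#|F|.-1) -> F -> C) (N m : nat) (D : 'M[F]_(N, m)) :
  orthonormal_contrasts c ->
  gwp c 1 D = N%:R ^- 2 *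
    \sum_i \sum_i' (#|F|%:R * (agreement D i i')%:R - m%:R).
Proof.
move=> hc; rewrite gwp_rows //; congr (_ * _).
apply: eq_bigr => i _; apply: eq_bigr => i' _.
rewrite -coef_prod_lin (coefs_prod_lin _).1 sumrB -mulr_sumr sum_agreement.
by rewrite sumr_const card_ord.
Qed.

Lemma gwp2_agreement (F : finFieldType) (C : numClosedFieldType)
    (c : 'I_(#|F|.-1) -> F -> C) (N m : nat) (D : 'M[F]_(N, m)) :
  orthonormal_contrasts c ->
  gwp c 2 D *+ 2 = N%:R ^- 2 * \sum_i \sum_i'
    ((#|F|%:R * (agreement D i i')%:R - m%:R) ^+ 2
     - (m%:R + #|F|%:R * (#|F|%:R - 2%:R) * (agreement D i i')%:R)).
Proof.
move=> hc; rewrite gwp_rows // -mulrnAr -sumrMnl; congr (_ * _).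
apply: eq_bigr => i _; rewrite -sumrMnl; apply: eq_bigr => i' _.
rewrite -coef_prod_lin (coefs_prod_lin _).2 sumrB -mulr_sumr sum_agreement.
rewrite sumr_const card_ord; congr (_ - _).
rewrite (eq_bigr (fun k =>
  1 + #|F|%:R * (#|F|%:R - 2%:R) * (D i k == D i' k)%:R)); last first.
  by move=> k _; case: eqP => _ /=; ring.
by rewrite big_split /= sumr_const card_ord -mulr_sumr sum_agreement.
Qed.

(** Double counting of the pairs of points of R with the same image. *)
Lemma sum_collisions (T V : finType) (R : {set T}) (phi : T -> V) :
  (\sum_(x in R) \sum_(y in R) (phi x == phi y) =
   \sum_v #|[set x in R | phi x == v]| ^ 2)%N.
Proof.
have cardE v : #|[set x in R | phi x == v]| = (\sum_(x in R) (phi x == v))%N.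
  rewrite -sum1_card [LHS]big_mkcond [RHS]big_mkcond /=; apply: eq_bigr => x _.
  by rewrite inE; case: (x \in R); case: eqP.
rewrite (eq_bigr (fun v => \sum_(x in R) \sum_(y in R)
    (phi x == v) * (phi y == v)))%N; last first.
  move=> v _; rewrite cardE -mulnn big_distrl; apply: eq_bigr => x _.
  by rewrite big_distrr.
rewrite [RHS]exchange_big /=; apply: eq_bigr => x _.
rewrite [RHS]exchange_big /=; apply: eq_bigr => y _.
rewrite (bigD1 (phi x)) //= eqxx mul1n big1 ?addn0 1?eq_sym // => v.
by rewrite eq_sym => /negPf->.
Qed.

Lemma balanced_muln (F : finFieldType) (N m : nat) (D : 'M[F]_(N, m)) (k : 'I_m) :
  balanced D -> (#|F| * (N %/ #|F|) = N)%N.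
Proof.
move=> /forallP/(_ k)/forallP bD.
have E : (N = \sum_u #|[set i | D i k == u]|)%N.
  rewrite -[LHS]card_ord -sum1_card (partition_big (fun i => D i k) xpredT) //=.
  by apply: eq_bigr => u _; rewrite -sum1_card; apply: eq_bigl => i; rewrite inE.
by rewrite -sum_nat_const [RHS]E; apply: eq_bigr => u _; rewrite (eqP (bD u)).
Qed.

Lemma balanced_sum_agreement (F : finFieldType) (N m : nat) (D : 'M[F]_(N, m)) :
  balanced D ->
  (\sum_i \sum_i' agreement D i i' = m * (#|F| * (N %/ #|F|) ^ 2))%N.
Proof.
move=> bD; rewrite -[m in RHS]card_ord -sum_nat_const.
transitivity (\sum_i \sum_i' \sum_k (D i k == D i' k))%N.
  apply: eq_bigr => i _; apply: eq_bigr => i' _.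
  have := sum_agreement nat D i i'; rewrite natn => <-.
  by apply: eq_bigr => k _; rewrite natn.
under eq_bigr do rewrite exchange_big; rewrite exchange_big /=.
apply: eq_bigr => k _.
have := sum_collisions [set: 'I_N] (D^~ k).
under eq_bigl do rewrite inE; under eq_bigr do under eq_bigl do rewrite inE.
move=> ->; rewrite -sum_nat_const; apply: eq_bigr => u _; congr (_ ^ 2)%N.
move/forallP/(_ k)/forallP/(_ u)/eqP: bD => <-.
by apply: eq_card => i; rewrite !inE.
Qed.

(** Balance alone fixes the mean agreement of two rows. *)
Lemma balanced_mean_agreement (K : comPzRingType) (F : finFieldType) (N m : nat)
    (D : 'M[F]_(N, m)) : balanced D ->
  #|F|%:R * (\sum_i \sum_i' (agreement D i i')%:R) = m%:R * N%:R ^+ 2 :> K.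
Proof.
move=> bD; under eq_bigr do rewrite -natr_sum.
rewrite -natr_sum balanced_sum_agreement // -natrX -!natrM; congr _%:R.
case: m D bD => [|m] D bD; first by rewrite !mul0n muln0.
have E := balanced_muln ord0 bD; move: (N %/ _)%N E => q E.
by rewrite -E; ring.
Qed.

Lemma gwp1_balanced (F : finFieldType) (C : numClosedFieldType)
    (c : 'I_(#|F|.-1) -> F -> C) (N m : nat) (D : 'M[F]_(N, m)) :
  orthonormal_contrasts c -> balanced D -> gwp c 1 D = 0.
Proof.
move=> hc bD; rewrite gwp1_agreement //.
under eq_bigr do rewrite sumrB sumr_const card_ord -mulr_sumr.
rewrite sumrB sumr_const card_ord -mulr_sumr balanced_mean_agreement //.
by rewrite -!mulrnA -natrX -natrM mulnn subrr mulr0.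
Qed.

(** The product (d - l) (d - l - 1) as a natural number: one of the two summands
    always vanishes by truncation.  It is zero exactly when d is l or l + 1. *)
Definition gap (l d : nat) : nat := (d - l) * (d - l.+1) + (l - d) * (l.+1 - d).

Lemma natr_gap (C : comPzRingType) (l d : nat) :
  (gap l d)%:R = (d%:R - l%:R) * (d%:R - l%:R - 1) :> C.
Proof.
have [ld|dl] := leqP d l; rewrite /gap.
  rewrite (eqP ld) mul0n add0n natrM !natrB ?(leqW ld) //.
  by rewrite -natr1; ring.
rewrite (eqP (ltnW dl)) mul0n addn0 natrM !natrB ?(ltnW dl) //.
by rewrite -natr1; ring.
Qed.

Lemma gap_eq0 (l d : nat) : (gap l d == 0)%N = (d == l) || (d == l.+1).
Proof. rewrite /gap; nia. Qed.

(** Two distinct rows agree in l or in l + 1 columns. *)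
Definition near_constant (T : eqType) (l N m : nat) (D : 'M[T]_(N, m)) : bool :=
  [forall i, forall i', (i != i') ==> (gap l (agreement D i i') == 0)%N].

Lemma muln_sum_ord (N x : nat) : (N * x = \sum_(i < N) x)%N.
Proof. by rewrite sum_nat_const card_ord. Qed.

Lemma mulrn_sum_ord (V : nmodType) (N : nat) (x : V) : x *+ N = \sum_(i < N) x.
Proof. by rewrite sumr_const card_ord. Qed.

Lemma sum_gap (T : eqType) (l N m : nat) (D : 'M[T]_(N, m)) :
  (\sum_i \sum_i' gap l (agreement D i i') =
    N * gap l m + \sum_i \sum_(i' | i' != i) gap l (agreement D i i'))%N.
Proof.
rewrite muln_sum_ord -big_split; apply: eq_bigr => i _.
by rewrite (bigD1 i) //= agreement_diag.
Qed.

Lemma near_constantP (T : eqType) (l N m : nat) (D : 'M[T]_(N, m)) :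
  reflect (\sum_i \sum_(i' | i' != i) gap l (agreement D i i') = 0)%N
          (near_constant l D).
Proof.
apply: (iffP idP) => [/forallP h|/eqP].
  apply: big1 => i _; apply: big1 => i' ii'; apply/eqP.
  by have /forallP/(_ i')/implyP := h i; apply; rewrite eq_sym.
rewrite sum_nat_eq0 => /forallP h; apply/forallP => i; apply/forallP => i'.
apply/implyP => ii'; have := h i; rewrite sum_nat_eq0 => /forallP/(_ i').
by rewrite eq_sym ii'.
Qed.

(** For a balanced design, the second wordlength is an increasing affine function
    of the total gap of its row agreements. *)
Lemma gwp2_gap (F : finFieldType) (C : numClosedFieldType)
    (c : 'I_(#|F|.-1) -> F -> C) (l N m : nat) (D : 'M[F]_(N, m)) :
  orthonormal_contrasts c -> balanced D -> (0 < N)%N ->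
  let q := #|F|%:R : C in
  gwp c 2 D *+ 2 =
    q ^+ 2 * (\sum_i \sum_i' gap l (agreement D i i'))%N%:R / N%:R ^+ 2
    + (2%:R * q * m%:R * l%:R - m%:R ^+ 2 + m%:R - q ^+ 2 * l%:R * (l%:R + 1)).
Proof.
move=> hc bD N0 q; rewrite gwp2_agreement // -/q.
have mean := balanced_mean_agreement C bD; rewrite -/q in mean.
have NC : N%:R != 0 :> C by rewrite pnatr_eq0 -lt0n.
pose u := q ^+ 2 * (2%:R * l%:R + 1) - 2%:R * q * m%:R - q * (q - 2%:R).
pose v := m%:R ^+ 2 - m%:R - q ^+ 2 * l%:R * (l%:R + 1).
have -> : \sum_i \sum_i' ((q * (agreement D i i')%:R - m%:R) ^+ 2
      - (m%:R + q * (q - 2%:R) * (agreement D i i')%:R)) =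
    q ^+ 2 * (\sum_i \sum_i' gap l (agreement D i i'))%N%:R
    + u * (\sum_i \sum_i' (agreement D i i')%:R) + v *+ N *+ N.
  rewrite natr_sum !mulr_sumr (mulrn_sum_ord N (v *+ N)) -!big_split /=.
  apply: eq_bigr => i _ /=.
  rewrite natr_sum !mulr_sumr (mulrn_sum_ord N v) -!big_split /=.
  by apply: eq_bigr => i' _; rewrite natr_gap /u /v; ring.
rewrite -mulrnA -[v *+ _]mulr_natr natrM.
have -> : u * (\sum_i \sum_i' (agreement D i i')%:R) =
    (q * (2%:R * l%:R + 1) - 2%:R * m%:R - (q - 2%:R)) * (m%:R * N%:R ^+ 2).
  by rewrite -mean /u; ring.
by rewrite /v; field.
Qed.

(** Over pairs of distinct rows of a near-constant design, every function of the
    agreement coincides with the affine function interpolating it at l and l + 1,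
    so its total depends only on the total agreement. *)
Lemma sum_linear_near_constant (C : comNzRingType) (T : eqType) (l N m : nat)
    (D : 'M[T]_(N, m)) (w : nat -> C) : near_constant l D ->
  \sum_i \sum_i' w (agreement D i i') =
  w m *+ N - (w l + (m%:R - l%:R) * (w l.+1 - w l)) *+ N
  + (w l - l%:R * (w l.+1 - w l)) *+ N *+ N
  + (w l.+1 - w l) * (\sum_i \sum_i' (agreement D i i')%:R).
Proof.
move=> /forallP ncD.
rewrite mulr_sumr -mulrnBl !(mulrn_sum_ord N) -!big_split /=.
apply: eq_bigr => i _; rewrite mulr_sumr -addrA -big_split /=.
rewrite (bigD1 i) //= [in RHS](bigD1 i) //= agreement_diag addrA; congr (_ + _).
  by ring.
apply: eq_bigr => i' ii'; have /forallP/(_ i') := ncD i.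
rewrite eq_sym ii' gap_eq0 => /orP[] /eqP->; first by ring.
by rewrite -[l.+1%:R]natr1; ring.
Qed.

(** A competitor with the same second wordlength is itself near-constant, and then
    all its wordlengths agree with those of D. *)
Lemma near_constant_GMA_optimal (F : finFieldType) (C : numClosedFieldType)
    (c : 'I_(#|F|.-1) -> F -> C) (l N m : nat) (D : 'M[F]_(N, m)) :
  orthonormal_contrasts c -> balanced D -> near_constant l D -> (0 < N)%N ->
  GMA_optimal c D.
Proof.
move=> hc bD ncD N0 [D' [r [[_ _ bD'] /andP[r0 _] eq_gwp]]].
have q0 : 0 < #|F|%:R :> C by rewrite ltr0n; apply/card_gt0P; exists 0.
have NC : 0 < N%:R :> C by rewrite ltr0n.
have gap_le : (\sum_i \sum_i' gap l (agreement D i i') <=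
               \sum_i \sum_i' gap l (agreement D' i i'))%N.
  by rewrite !sum_gap (near_constantP _ _ ncD) addn0 leq_addr.
have gwp2_le : gwp c 2 D <= gwp c 2 D'.
  rewrite -(@ler_pMn2r _ 2) // !(gwp2_gap l) // lerD2r.
  by rewrite ler_wpM2r ?invr_ge0 ?exprn_ge0 ?ler0n // ler_wpM2l ?exprn_ge0 ?ler0n ?ler_nat.
case: r r0 eq_gwp => [|[|[|r]]] // _ eq_gwp.
- by rewrite !gwp1_balanced // ltxx.
- by move/(le_lt_trans gwp2_le); rewrite ltxx.
have ncD' : near_constant l D'.
  have /(congr1 (fun z => z *+ 2)) := eq_gwp 2 isT.
  rewrite !(gwp2_gap l) // => /addIr/mulIf; rewrite invr_eq0 expf_eq0 gt_eqF //.
  move=> /(_ isT)/mulfI; rewrite expf_eq0 gt_eqF // => /(_ isT)/eqP.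
  rewrite eqr_nat !sum_gap (near_constantP _ _ ncD) eqn_add2l => /eqP ?.
  exact/near_constantP.
rewrite !gwp_agreement //.
rewrite (sum_linear_near_constant (fun d => (agreement_poly _ m d)`_r.+3) ncD).
rewrite (sum_linear_near_constant (fun d => (agreement_poly _ m d)`_r.+3) ncD').
have <- : \sum_i \sum_i' (agreement D i i')%:R =
         \sum_i \sum_i' (agreement D' i i')%:R :> C.
  by apply: (mulfI (lt0r_neq0 q0)); rewrite !balanced_mean_agreement.
by rewrite ltxx.
Qed.

(** * Points, linear forms and the columns of Q1 *)

(** All values of phi are taken equally often on R. *)
Definition equidistributed (T G : finType) (R : {set T}) (phi : T -> G) : Prop :=
  forall v, (#|[set x in R | phi x == v]| * #|G| = #|R|)%N.

(** A function is equidistributed as soon as each translation of its values is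
    induced by an injection of R into itself. *)
Lemma equidistributed_shift (T : finType) (G : finZmodType) (R : {set T})
    (phi : T -> G) (tau : G -> T -> T) :
  (forall w, injective (tau w)) ->
  (forall w x, x \in R -> tau w x \in R) ->
  (forall w x, x \in R -> phi (tau w x) = phi x + w) ->
  equidistributed R phi.
Proof.
move=> tau_inj tauR phi_tau.
have le u v : (#|[set x in R | phi x == u]| <= #|[set x in R | phi x == v]|)%N.
  rewrite -(card_imset _ (tau_inj (v - u))); apply: subset_leq_card.
  apply/subsetP => _ /imsetP[x /[!inE] /andP[xR /eqP xu] ->].
  by rewrite tauR // phi_tau // xu addrC subrK eqxx.
move=> v; rewrite mulnC -sum_nat_const -[RHS]sum1_card.
rewrite [RHS](partition_big phi xpredT) //=; apply: eq_bigr => u _.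
have -> : #|[set x in R | phi x == v]| = #|[set x in R | phi x == u]|.
  by apply/eqP; rewrite eqn_leq !le.
by rewrite -sum1_card; apply: eq_bigl => x; rewrite inE.
Qed.

Section Geometry.
Variables (F : finFieldType) (n : nat).
Implicit Types (d x y z : 'rV[F]_n.+2) (a t : F).

(** Coordinates start at 0: basis_vector 0 is the direction of X_1 and
    basis_vector 1 that of X_2. *)
Definition basis_vector (j : 'I_n.+2) : 'rV[F]_n.+2 := delta_mx 0 j.

Lemma basis_vectorE i j : basis_vector j 0 i = (i == j)%:R.
Proof. by rewrite mxE eqxx. Qed.

Lemma shiftE x t j i : (x + t *: basis_vector j) 0 i = x 0 i + t * (i == j)%:R.
Proof. by rewrite !mxE eqxx. Qed.

Lemma linear_form_add d x t j :
  linear_form d (x + t *: basis_vector j) = linear_form d x + t * d 0 j.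
Proof.
rewrite !ffunE (eq_bigr (fun i => d 0 i * x 0 i + t * (d 0 i * (i == j)%:R))).
  rewrite big_split /= -mulr_sumr; congr (_ + _ * _).
  rewrite (bigD1 j) //= eqxx mulr1 big1 ?addr0 // => i /negPf->.
  by rewrite mulr0.
by move=> i _; rewrite shiftE; ring.
Qed.

Lemma linear_form0 d : linear_form d 0 = 0.
Proof. by rewrite ffunE big1 // => i _; rewrite mxE mulr0. Qed.

Lemma linear_form_basis d j : linear_form d (basis_vector j) = d 0 j.
Proof.
by rewrite -[basis_vector j]add0r -[basis_vector j]scale1r linear_form_add
  linear_form0 add0r mul1r.
Qed.

Lemma linear_formB d x y : linear_form d (x - y) = linear_form d x - linear_form d y.
Proof.
by rewrite !ffunE -sumrB; apply: eq_bigr => i _; rewrite !mxE mulrBr.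
Qed.

Lemma linear_formDl d d' x :
  linear_form (d + d') x = linear_form d x + linear_form d' x.
Proof.
by rewrite !ffunE -big_split; apply: eq_bigr => i _; rewrite !mxE mulrDl.
Qed.

Lemma linear_formZl t d x : linear_form (t *: d) x = t * linear_form d x.
Proof.
by rewrite !ffunE mulr_sumr; apply: eq_bigr => i _; rewrite !mxE mulrA.
Qed.

Lemma linear_form_basisl j x : linear_form (basis_vector j) x = x 0 j.
Proof.
rewrite ffunE (bigD1 j) //= basis_vectorE eqxx mul1r big1 ?addr0 // => i.
by rewrite basis_vectorE => /negPf->; rewrite mul0r.
Qed.

(** The coefficient vectors of the forms in H: nonzero, without X_1 term, and with
    last nonzero coefficient 1. *)
Definition normalized : {set 'rV[F]_n.+2} :=
  [set d : 'rV[F]_n.+2 | (d 0 0 == 0) &&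
        [exists i : 'I_n.+2, (d 0 i == 1) &&
           [forall j : 'I_n.+2, (i < j)%N ==> (d 0 j == 0)]]].

Lemma normalizedP d :
  reflect (d 0 0 = 0 /\ exists2 i : 'I_n.+2,
             d 0 i = 1 & forall j : 'I_n.+2, (i < j)%N -> d 0 j = 0)
          (d \in normalized).
Proof.
rewrite inE; apply: (iffP andP) => -[/eqP d0].
  case/existsP=> i /andP[/eqP di /forallP dj]; split=> //; exists i => // j ij.
  by apply/eqP; have := dj j; rewrite ij.
case=> i di dj; rewrite d0; split=> //; apply/existsP; exists i; rewrite di eqxx.
by apply/forallP => j; apply/implyP => /dj->.
Qed.

Lemma normalized_neq0 d : d \in normalized -> d != 0.
Proof.
case/normalizedP => _ [i di _]; apply: contra_eq_neq di => ->.
by rewrite mxE eq_sym oner_neq0.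
Qed.

Lemma normalized_scale d : d 0 0 = 0 -> d != 0 ->
  exists2 t, t != 0 & t^-1 *: d \in normalized.
Proof.
move=> d0 dn0; have [i0 di0] : exists i, d 0 i != 0.
  apply/existsP; apply: contraNT dn0 => /existsPn h.
  by apply/eqP/rowP => i; rewrite mxE; apply/eqP; have := h i; rewrite negbK.
case: (@arg_maxnP _ i0 (fun i => d 0 i != 0) val di0) => i di imax.
exists (d 0 i) => //; apply/normalizedP; split; first by rewrite mxE d0 mulr0.
exists i; first by rewrite mxE mulVf.
move=> j ij; rewrite mxE; have [->|/imax] := eqVneq (d 0 j) 0; first by rewrite mulr0.
by rewrite /= leqNgt ij.
Qed.

Lemma normalized_scale_inj t t' d d' : d \in normalized -> d' \in normalized ->
  t != 0 -> t' != 0 -> t *: d = t' *: d' -> t = t' /\ d = d'.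
Proof.
move=> /normalizedP[_ [i di dj]] /normalizedP[_ [i' di' dj']] t0 t0' /rowP E.
have ii' : i = i'.
  apply/val_inj/eqP; case: ltngtP => // [ii'|ii'].
    have := E i'; rewrite !mxE dj // di' mulr0 mulr1 => /esym/eqP.
    by rewrite (negPf t0').
  have := E i; rewrite !mxE dj' // di mulr0 mulr1 => /eqP.
  by rewrite (negPf t0).
have tt' : t = t' by have := E i; rewrite !mxE di ii' di' !mulr1.
split=> //; apply/rowP => j; have := E j; rewrite !mxE -tt'.
exact: mulfI.
Qed.

(** Each nonzero vector of a cone A is a unique multiple of a normalized one. *)
Lemma card_normalized_cap (A : {set 'rV[F]_n.+2}) :
  (forall d, d \in A -> d 0 0 = 0) ->
  (forall t d, t != 0 -> d \in A -> t *: d \in A) ->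
  0 \in A -> ((#|F| - 1) * #|normalized :&: A| + 1 = #|A|)%N.
Proof.
move=> A0 Asc z0A.
have -> : (#|F| - 1)%N = #|[set~ 0 : F]|.
  by rewrite cardsC1 subn1.
rewrite -cardsX -(@card_in_imset _ _ (fun p => p.1 *: p.2)); last first.
  move=> [t d] [t' d'] /=; rewrite !in_setX !in_setC1 !in_setI => /and3P[t0 dn _].
  case/and3P=> t0' dn' _ E.
  by have [/= -> ->] := normalized_scale_inj dn dn' t0 t0' E.
rewrite (cardsD1 0 A) z0A addnC; congr (_ + _)%N.
apply: eq_card => d; rewrite !inE; apply/imsetP/andP => [[[t d'] /=]|[dn0 dA]].
  rewrite in_setX /= in_setC1 in_setI => /and3P[t0 dn' dA ->].
  by rewrite Asc // scaler_eq0 negb_or t0 normalized_neq0.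
have [t t0 nd] := normalized_scale (A0 d dA) dn0.
exists (t, t^-1 *: d); last by rewrite /= scalerA mulfV // scale1r.
by rewrite in_setX /= in_setC1 t0 in_setI nd Asc ?invr_eq0.
Qed.

Lemma card_rV : #|{: 'rV[F]_n.+2}| = (#|F| ^ n.+2)%N.
Proof. by rewrite card_mx mul1n. Qed.

Lemma card_F_gt0 : (0 < #|F|)%N.
Proof. by apply/card_gt0P; exists 0. Qed.

Lemma card_F_gt1 : (1 < #|F|)%N.
Proof. by apply/card_gt1P; exists 0, 1; rewrite eq_sym oner_neq0. Qed.

Lemma card_tail : #|[set d : 'rV[F]_n.+2 | d 0 0 == 0]| = (#|F| ^ n.+1)%N.
Proof.
have /(_ 0) : equidistributed [set: 'rV[F]_n.+2] (fun d : 'rV[F]_n.+2 => d 0 0).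
  apply: (@equidistributed_shift _ _ _ _ (fun t d => d + t *: basis_vector 0)).
  - by move=> t; exact: addIr.
  - by move=> t d _; rewrite inE.
  - by move=> t d _; rewrite shiftE eqxx mulr1.
rewrite cardsT card_rV expnSr => /eqP; rewrite eqn_pmul2r ?card_F_gt0 // => /eqP <-.
by apply: eq_card => d; rewrite !inE.
Qed.

Lemma card_tail_orthogonal z : z 0 0 = 0 -> z != 0 ->
  #|[set d : 'rV[F]_n.+2 | (d 0 0 == 0) && (linear_form d z == 0)]| = (#|F| ^ n)%N.
Proof.
move=> z0 zn0; have [j zj] : exists j, z 0 j != 0.
  apply/existsP; apply: contraNT zn0 => /existsPn h.
  by apply/eqP/rowP => i; rewrite mxE; apply/eqP; have := h i; rewrite negbK.
have j0 : (0 == j) = false by apply: contraNF zj => /eqP <-; rewrite z0.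
have /(_ 0) : equidistributed [set d : 'rV[F]_n.+2 | d 0 0 == 0]
    (fun d => linear_form d z).
  apply: (@equidistributed_shift _ _ _ _
            (fun t d => d + (t / z 0 j) *: basis_vector j)).
  - by move=> t; exact: addIr.
  - move=> t d; by rewrite !inE shiftE j0 mulr0 addr0.
  - move=> t d _; rewrite linear_formDl linear_formZl linear_form_basisl.
    by rewrite divfK.
rewrite card_tail expnSr => /eqP; rewrite eqn_pmul2r ?card_F_gt0 // => /eqP <-.
by apply: eq_card => d; rewrite !inE.
Qed.

Lemma card_normalized : ((#|F| - 1) * #|normalized| + 1 = #|F| ^ n.+1)%N.
Proof.
rewrite -card_tail.
rewrite -[RHS]card_normalized_cap => [|d|t d _|]; rewrite ?inE.
- congr ((_ * _) + _)%N; apply: eq_card => d; rewrite !inE.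
  by case: (d 0 0 == 0); rewrite ?andbT.
- by move/eqP.
- by rewrite mxE => /eqP->; rewrite mulr0.
- by rewrite mxE.
Qed.

Lemma card_normalized_orthogonal z : z 0 0 = 0 -> z != 0 ->
  ((#|F| - 1) * #|[set d in normalized | linear_form d z == 0%R]| + 1
   = #|F| ^ n)%N.
Proof.
move=> z0 zn0; rewrite -(card_tail_orthogonal z0 zn0) -[RHS]card_normalized_cap.
- congr ((_ * _) + _)%N; apply: eq_card => d; rewrite !inE.
  by case: (d 0 0 == 0).
- by move=> d; rewrite inE => /andP[/eqP].
- move=> t d _; rewrite !inE linear_formZl mxE => /andP[/eqP-> /eqP->].
  by rewrite !mulr0 eqxx.
- rewrite inE mxE eqxx; apply/eqP; rewrite ffunE big1 // => i _.
  by rewrite mxE mul0r.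
Qed.

(** The column X_1^2 + a X_1 + h, where h has coefficient vector d. *)
Definition quad (p : F * 'rV[F]_n.+2) : {ffun 'rV[F]_n.+2 -> F} :=
  quadratic_column p.1 (linear_form p.2).

Lemma quadE a d x : quad (a, d) x = x 0 0 ^+ 2 + a * x 0 0 + linear_form d x.
Proof. by rewrite ffunE. Qed.

Lemma X1E x : X1 F n x = x 0 0.
Proof. by rewrite ffunE. Qed.

Lemma quad_inj : {in [pred p : F * 'rV[F]_n.+2 | p.2 0 0 == 0] &, injective quad}.
Proof.
move=> [a d] [a' d'] /[!inE] /= /eqP d0 /eqP d0' E.
have dd' : d = d'.
  apply/rowP => i; have [->|i0] := eqVneq i 0; first by rewrite d0 d0'.
  have := congr1 (fun f : {ffun _} => f (basis_vector i)) E.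
  by rewrite !quadE !linear_form_basis basis_vectorE eq_sym (negPf i0) !mulr0
    => /addrI.
have := congr1 (fun f : {ffun _} => f (basis_vector 0)) E.
by rewrite -dd' !quadE basis_vectorE eqxx !mulr1 => /addIr/addrI->.
Qed.

Lemma quad_neq_X1 a d : d \in normalized -> quad (a, d) != X1 F n.
Proof.
case/normalizedP => d0 [i di _]; have i0 : (0 == i) = false.
  by apply: contra_eqF di => /eqP<-; rewrite d0 eq_sym oner_neq0.
apply/eqP => /(congr1 (fun f : {ffun _} => f (basis_vector i))).
rewrite quadE linear_form_basis X1E basis_vectorE i0 di expr0n mulr0 !add0r.
by move/eqP; rewrite oner_eq0.
Qed.

Lemma branchingE : branching F n = quad (0, basis_vector 1).
Proof.
by apply/ffunP => x; rewrite quadE linear_form_basisl ffunE mul0r addr0.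
Qed.

Lemma basis1_normalized : basis_vector 1 \in normalized.
Proof.
apply/normalizedP; rewrite basis_vectorE; split=> //; exists 1.
  by rewrite basis_vectorE eqxx.
move=> j j1; rewrite basis_vectorE; case: eqP => // E; move: j1.
by rewrite E ltnn.
Qed.

Lemma Q1E : Q1 F n = X1 F n |: [set quad p | p in setX [set: F] normalized].
Proof.
congr (_ |: _); apply/setP => f; apply/imset2P/imsetP.
  move=> [a h _ /imsetP[d dn ->] ->]; exists (a, d) => //.
  by rewrite !inE in dn *.
case=> [[a d]]; rewrite inE => /andP[_ dn] ->.
by exists a (linear_form d) => //; apply/imsetP; exists d.
Qed.

Lemma quad_norm_inj : {in setX [set: F] normalized &, injective quad}.
Proof.
move=> p p' /[!inE] /= /andP[p0 _] /andP[p0' _]; apply: quad_inj; exact.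
Qed.

Lemma card_Q1_pred (P : pred {ffun 'rV[F]_n.+2 -> F}) :
  #|[set f in Q1 F n | P f]| =
  (P (X1 F n) + #|[set p : F * 'rV[F]_n.+2 | (p.2 \in normalized) && P (quad p)]|)%N.
Proof.
rewrite (cardsD1 (X1 F n)) inE Q1E setU11 /=; congr (_ + _)%N.
rewrite -(@card_in_imset _ _ quad); last first.
  move=> p p'; case: p => a d; case: p' => a' d'.
  rewrite in_set => /andP[pn _]; rewrite in_set => /andP[pn' _] E.
  by apply: quad_norm_inj E; rewrite in_setX in_setT.
apply: eq_card => f; rewrite in_setD1 in_set in_setU1.
apply/and3P/imsetP.
  move=> [fX /orP[/eqP fX'|/imsetP[p pn ->] Pp]]; first by rewrite fX' eqxx in fX.
  exists p => //; case: p pn Pp => a d; rewrite in_setX in_setT in_set /= => ->.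
  by move=> ->.
case=> -[a d]; rewrite in_set => /andP[pn Pp] ->; split=> //; first exact: quad_neq_X1.
by rewrite imset_f ?orbT // in_setX in_setT.
Qed.

Lemma card_Q1 : #|Q1 F n| = (1 + #|F| * #|normalized|)%N.
Proof.
have := card_Q1_pred predT; rewrite -cardsT -cardsX => E.
transitivity #|[set f in Q1 F n | predT f]|.
  by apply: eq_card => f; rewrite inE andbT.
by rewrite E; congr (_ + _)%N; apply: eq_card => -[a d]; rewrite in_set in_setX in_setT andbT.
Qed.

(** Any two distinct points agree in the same number of columns of Q1.  If their
    first coordinates differ, each h has exactly one a for which the column does
    not separate them; otherwise X1 does not, and the forms h to be counted are
    those vanishing on their difference. *)
Lemma card_Q1_agree x y : x != y ->
  #|[set f in Q1 F n | f x == f y]| = #|normalized|.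
Proof.
move=> xy; rewrite (card_Q1_pred (fun f => f x == f y)) !X1E.
have [xy0|xy0] := eqVneq (x 0 0) (y 0 0).
  have z0 : (x - y) 0 0 = 0 by rewrite !mxE xy0 subrr.
  have zn0 : x - y != 0 by rewrite subr_eq0.
  have -> : [set p | (p.2 \in normalized) && (quad p x == quad p y)] =
      setX [set: F] [set d in normalized | linear_form d (x - y) == 0].
    apply/setP => -[a d]; rewrite in_setX !in_set /= !quadE xy0 linear_formB.
    by rewrite subr_eq0 (inj_eq (addrI _)).
  rewrite cardsX cardsT; have := card_normalized.
  rewrite expnS -(card_normalized_orthogonal z0 zn0).
  have := card_F_gt1.
  set s := #|F|; set u := #|normalized|; set v := #|[set _ in _ | _]|.
  case: s => // -[] // s _ E; apply/eqP; rewrite -(eqn_pmul2l (ltn0Sn s)).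
  by move: E; rewrite subn1 /=; nia.
rewrite add0n.
(* al d is the only a such that quad (a, d) takes the same value at x and y *)
pose al d := - (x 0 0 + y 0 0 + (linear_form d (x - y)) / (x 0 0 - y 0 0)).
rewrite -(@card_in_imset _ _ (fun d => (al d, d))); last by move=> d d' _ _ [].
apply: eq_card => -[a d]; rewrite in_set /= !quadE.
have xyd : x 0 0 - y 0 0 != 0 by rewrite subr_eq0.
have -> : (x 0 0 ^+ 2 + a * x 0 0 + linear_form d x ==
           y 0 0 ^+ 2 + a * y 0 0 + linear_form d y) = (a == al d).
  rewrite /al linear_formB -subr_eq0 -[RHS]subr_eq0.
  rewrite -[RHS](mulrI_eq0 _ (mulfI xyd)).
  by congr (_ == 0); field.
apply/andP/imsetP => [[dn /eqP->]|[d' dn' [-> ->]]] //; by exists d.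
Qed.

End Geometry.

(** * The juxtaposition of fractions *)

Lemma card_enum_pred (T : finType) (A : {set T}) (P : pred T) :
  #|[set i : 'I_#|A| | P (enum_val i)]| = #|[set x in A | P x]|.
Proof.
rewrite -(card_imset _ enum_val_inj); apply: eq_card => x; rewrite in_set.
apply/imsetP/andP => [[i /[!inE] Pi ->]|[xA Px]]; first by rewrite enum_valP.
by exists (enum_rank_in xA x); rewrite ?in_set enum_rankK_in.
Qed.

Section Design.
Variables (F : finFieldType) (n : nat) (S : {set F}).
Implicit Types (d x y : 'rV[F]_n.+2) (a t z : F) (f g : {ffun 'rV[F]_n.+2 -> F}).

Notation basis_vector := (@basis_vector F n).
Notation normalized := (normalized F n).

Definition design_rows := [set x : 'rV[F]_n.+2 | branching F n x \in S].
Definition design_cols := Q1 F n :\ branching F n.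

Lemma branching_val x : branching F n x = x 0 0 ^+ 2 + x 0 1.
Proof. by rewrite ffunE. Qed.

Lemma branching_shift1 x t :
  branching F n (x + t *: basis_vector 1) = branching F n x + t.
Proof. by rewrite !branching_val !shiftE eqxx mulr0 addr0 mulr1 addrA. Qed.

Lemma branching_shift x t (i : 'I_n.+2) : (1 < i)%N ->
  branching F n (x + t *: basis_vector i) = branching F n x.
Proof.
move=> i1; rewrite !branching_val !shiftE.
by case: eqP i1 => [<-|_] //; case: eqP => [<-|_] // _; rewrite !mulr0 !addr0.
Qed.

Lemma card_branching_level z :
  #|[set x | branching F n x == z]| = (#|F| ^ n.+1)%N.
Proof.
have /(_ z) : equidistributed [set: 'rV[F]_n.+2] (branching F n).
  apply: (@equidistributed_shift _ _ _ _ (fun t d => d + t *: basis_vector 1)).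
  - by move=> t; exact: addIr.
  - by move=> t d _; rewrite inE.
  - by move=> t d _; rewrite branching_shift1.
rewrite cardsT card_rV expnSr => /eqP; rewrite eqn_pmul2r ?card_F_gt0 // => /eqP <-.
by apply: eq_card => d; rewrite !inE.
Qed.

Lemma card_design_rows : #|design_rows| = (#|S| * #|F| ^ n.+1)%N.
Proof.
rewrite -sum_nat_const -sum1_card (partition_big (branching F n) (mem S)) /=.
  apply: eq_bigr => z zS; rewrite -(card_branching_level z) -sum1_card.
  by apply: eq_bigl => x; rewrite !inE; case: eqP => [->|]; rewrite ?andbF ?zS.
by move=> x; rewrite inE.
Qed.

Lemma card_X1_branching t z :
  #|[set x : 'rV[F]_n.+2 | (x 0 0 == t) && (branching F n x == z)]| = (#|F| ^ n)%N.
Proof.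
have c0 : #|[set x : 'rV[F]_n.+2 | x 0 0 == t]| = (#|F| ^ n.+1)%N.
  have /(_ t) : equidistributed [set: 'rV[F]_n.+2] (fun x : 'rV[F]_n.+2 => x 0 0).
    apply: (@equidistributed_shift _ _ _ _ (fun t d => d + t *: basis_vector 0)).
    - by move=> u; exact: addIr.
    - by move=> u d _; rewrite inE.
    - by move=> u d _; rewrite shiftE eqxx mulr1.
  rewrite cardsT card_rV expnSr => /eqP; rewrite eqn_pmul2r ?card_F_gt0 // => /eqP <-.
  by apply: eq_card => d; rewrite !inE.
have /(_ z) : equidistributed [set x : 'rV[F]_n.+2 | x 0 0 == t] (branching F n).
  apply: (@equidistributed_shift _ _ _ _ (fun t d => d + t *: basis_vector 1)).
  - by move=> u; exact: addIr.
  - by move=> u d; rewrite !inE shiftE mulr0 addr0.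
  - by move=> u d _; rewrite branching_shift1.
rewrite c0 expnSr => /eqP; rewrite eqn_pmul2r ?card_F_gt0 // => /eqP <-.
by apply: eq_card => d; rewrite !inE.
Qed.

(** Translation of X_1 by t, with X_2 corrected so that the level of the branching
    column is preserved. *)
Definition level_shift t x : 'rV[F]_n.+2 :=
  x + t *: basis_vector 0
    + (x 0 0 ^+ 2 - (x 0 0 + t) ^+ 2) *: basis_vector 1.

Lemma level_shiftE t x : level_shift t x 0 0 = x 0 0 + t.
Proof. by rewrite !shiftE eqxx mulr0 addr0 mulr1. Qed.

Lemma branching_level_shift t x :
  branching F n (level_shift t x) = branching F n x.
Proof.
by rewrite branching_shift1 !branching_val !shiftE eqxx mulr0 addr0 mulr1; ring.
Qed.

Lemma level_shift_inj t : injective (level_shift t).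
Proof.
apply: (can_inj (g := level_shift (- t))) => x; apply/rowP => i.
by rewrite !shiftE eqxx /=; ring.
Qed.

(** X_1 and the columns X_1^2 + a X_1 + X_2 with a nonzero: each of them is a
    nonzero multiple of X_1, plus possibly the branching column. *)
Definition pencil : {set {ffun 'rV[F]_n.+2 -> F}} :=
  X1 F n |: [set quad (a, basis_vector 1) | a in [set~ 0]].

Lemma pencilP f : f \in pencil ->
  (f = X1 F n) \/ (exists2 a, a != 0 & f = quad (a, basis_vector 1)).
Proof.
rewrite in_setU1 => /orP[/eqP->|/imsetP[a]]; first by left.
by rewrite in_setC1 => a0 ->; right; exists a.
Qed.

Lemma quad_basis1 a x :
  quad (a, basis_vector 1) x = branching F n x + a * x 0 0.
Proof. by rewrite quadE linear_form_basisl branching_val addrAC. Qed.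

(** The normalized vectors other than X_2; their last nonzero coefficient lies
    beyond X_2. *)
Definition tail_normalized := normalized :\ basis_vector 1.

Lemma tail_normalizedP d : d \in tail_normalized ->
  d 0 0 = 0 /\ exists i : 'I_n.+2, [/\ (1 < i)%N, d 0 i = 1 &
     forall j : 'I_n.+2, (i < j)%N -> d 0 j = 0].
Proof.
rewrite in_setD1 => /andP[d1 /normalizedP[d0 [i di dj]]]; split=> //.
exists i; split=> //; rewrite ltnNge; apply: contra d1 => i1; apply/eqP/rowP => j.
rewrite basis_vectorE; case: (ltnP i j) => [/[dup] /dj -> ij|ji].
  case: eqP => // E; move: i1 ij di; rewrite E.
  case: i dj => -[|[|i]] //= ii _ _ _; rewrite (_ : Ordinal ii = 0) ?d0; last exact: val_inj.
  by move/eqP; rewrite eq_sym oner_eq0.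
case: eqP => [->|j1].
  case: i di i1 {dj ji} => -[|[|i]] //= ii; last first.
    by rewrite (_ : Ordinal ii = 1) //; exact: val_inj.
  rewrite (_ : Ordinal ii = 0) ?d0; last exact: val_inj.
  by move/eqP; rewrite eq_sym oner_eq0.
suff -> : j = 0 by rewrite d0.
apply: val_inj; case: j ji j1 => -[|[|j]] //= jj ji j1.
  by case: j1; exact: val_inj.
by have := leq_trans ji i1.
Qed.

Lemma design_colsP f : f \in design_cols ->
  (f \in pencil) \/ (exists a, exists2 d, d \in tail_normalized & f = quad (a, d)).
Proof.
rewrite in_setD1 => /andP[fb]; rewrite Q1E in_setU1 => /orP[/eqP->|].
  by left; rewrite in_setU1 eqxx.
case/imsetP => -[a d]; rewrite in_setX => /andP[_ dn] E.
have [d1|d1] := eqVneq d (basis_vector 1); last first.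
  by right; exists a, d; rewrite // in_setD1 d1.
left; rewrite in_setU1; apply/orP; right; apply/imsetP; exists a; last by rewrite -d1.
by rewrite in_setC1; apply: contraNneq fb => a0; rewrite E a0 d1 branchingE.
Qed.

Lemma equidistributed_pencil f : f \in pencil -> equidistributed design_rows f.
Proof.
case/pencilP => [->|[a a0 ->]].
  apply: (@equidistributed_shift _ _ _ _ level_shift).
  - exact: level_shift_inj.
  - by move=> t x; rewrite !inE branching_level_shift.
  - by move=> t x _; rewrite !X1E level_shiftE.
apply: (@equidistributed_shift _ _ _ _ (fun t => level_shift (t / a))).
- by move=> t; exact: level_shift_inj.
- by move=> t x; rewrite !inE branching_level_shift.
- move=> t x _; rewrite !quad_basis1 branching_level_shift level_shiftE.
  by field.
Qed.

Lemma quad_shift a d x t (i : 'I_n.+2) : (1 < i)%N ->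
  quad (a, d) (x + t *: basis_vector i) = quad (a, d) x + t * d 0 i.
Proof.
move=> i1; rewrite !quadE linear_form_add shiftE.
by case: eqP i1 => [<-|_] // _; rewrite mulr0 addr0 addrA.
Qed.

Lemma X1_shift x t (i : 'I_n.+2) : (1 < i)%N ->
  X1 F n (x + t *: basis_vector i) = X1 F n x.
Proof.
by move=> i1; rewrite !X1E shiftE; case: eqP i1 => [<-|_] // _; rewrite mulr0 addr0.
Qed.

Lemma pencil_shift f x t (i : 'I_n.+2) : f \in pencil -> (1 < i)%N ->
  f (x + t *: basis_vector i) = f x.
Proof.
move=> fP i1; case/pencilP: fP => [->|[a a0 ->]]; first by rewrite X1_shift.
rewrite quad_shift // basis_vectorE.
by case: eqP i1 => [->|_] //; rewrite mulr0 addr0.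
Qed.

Lemma equidistributed_quad a d (i : 'I_n.+2) (R : {set 'rV[F]_n.+2}) : (1 < i)%N ->
  (forall t x, x \in R -> x + t *: basis_vector i \in R) -> d 0 i != 0 ->
  equidistributed R (quad (a, d)).
Proof.
move=> i1 RS di; apply: (@equidistributed_shift _ _ _ _
   (fun t x => x + (t / d 0 i) *: basis_vector i)).
- by move=> t; exact: addIr.
- by move=> t x; exact: RS.
- by move=> t x xR; rewrite quad_shift // divfK.
Qed.

Lemma equidistributed_design_cols f : f \in design_cols ->
  equidistributed design_rows f.
Proof.
case/design_colsP => [/equidistributed_pencil //|[a [d dn ->]]].
have [_ [i [i1 di _]]] := tail_normalizedP dn.
apply: (equidistributed_quad a i1); last by rewrite di oner_neq0.
by move=> t x; rewrite !inE branching_shift.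
Qed.

Lemma branching_Q1 : branching F n \in Q1 F n.
Proof.
rewrite Q1E in_setU1 branchingE imset_f ?orbT // in_setX in_setT.
exact: basis1_normalized.
Qed.

Lemma card_design_cols : #|design_cols| = (#|F| * #|normalized|)%N.
Proof.
by have := cardsD1 (branching F n) (Q1 F n); rewrite branching_Q1 card_Q1 => /addnI->.
Qed.

Notation D := (juxtaposition n S).

Lemma juxtaposition_val i j : D i j = (enum_val j : {ffun _}) (enum_val i).
Proof. by rewrite mxE. Qed.

Lemma balanced_juxtaposition : balanced D.
Proof.
apply/forallP => k; apply/forallP => u; apply/eqP.
have E := equidistributed_design_cols (enum_valP k) u.
rewrite -[RHS](_ : #|[set x in design_rows | (enum_val k : {ffun _}) x == u]| = _).
  rewrite -(card_enum_pred _ (fun x => (enum_val k : {ffun _}) x == u)).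
  by apply: eq_card => i; rewrite !inE juxtaposition_val.
by rewrite -[in RHS]E mulnK ?card_F_gt0.
Qed.

(** Two rows agree in as many columns of Q1 as there are normalized vectors, and
    in one less once the branching column is removed if it does not separate
    them. *)
Lemma near_constant_juxtaposition : near_constant #|normalized|.-1 D.
Proof.
apply/forallP => i; apply/forallP => i'; apply/implyP => ii'.
have xy : (enum_val i : 'rV[F]_n.+2) != enum_val i'.
  by rewrite (inj_eq enum_val_inj).
have -> : agreement D i i' = #|[set f in design_cols |
    (f : {ffun _}) (enum_val i) == f (enum_val i')]|.
  rewrite -(card_enum_pred _ (fun f : {ffun 'rV[F]_n.+2 -> F} =>
    f (enum_val i) == f (enum_val i'))).
  by apply: eq_card => j; rewrite !inE !juxtaposition_val.
have := cardsD1 (branching F n)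
  [set f in Q1 F n | (f : {ffun _}) (enum_val i) == f (enum_val i')].
rewrite (card_Q1_agree xy) => ->.
set b := branching F n \in _; set A := [set f in design_cols | _].
set B := _ :\ _; have -> : #|B| = #|A|.
  by apply: eq_card => f; rewrite !inE andbA.
by rewrite gap_eq0; case: b; lia.
Qed.

End Design.

(** * Projected wordlengths and combination counts *)

Section Pairs.
Variables (F : finFieldType) (C : numClosedFieldType).
Variables (c : 'I_(#|F|.-1) -> F -> C) (hc : orthonormal_contrasts c).
Variables (N m : nat) (D : 'M[F]_(N, m)) (bD : balanced D) (N0 : (0 < N)%N).
Implicit Type p : 'I_m * 'I_m.

Let q : C := #|F|%:R.

Lemma sum_combination_count p :
  (\sum_uv combination_count D p uv = N)%N.
Proof.
rewrite -[RHS]card_ord -[RHS]sum1_card.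
rewrite [RHS](partition_big (fun i => (D i p.1, D i p.2)) xpredT) //=.
apply: eq_bigr => uv _; rewrite /combination_count -sum1_card.
by apply: eq_bigl => i; rewrite inE -pair_eqE.
Qed.

Lemma balanced_pair_design p : balanced (pair_design D p).
Proof.
move/forallP: bD => b; apply/forallP => l; apply/forallP => u.
have /forallP/(_ u)/eqP <- := b (if l == 0 then p.1 else p.2).
by apply/eqP/eq_card => i; rewrite !inE mxE.
Qed.

Lemma projected_A2_combinations p :
  projected_A2 c D p =
  q ^+ 2 * (\sum_uv combination_count D p uv ^ 2)%N%:R / N%:R ^+ 2 - 1.
Proof.
have NC : N%:R != 0 :> C by rewrite pnatr_eq0 -lt0n.
apply: (@mulIf _ 2%:R); first by rewrite pnatr_eq0.
rewrite mulr_natr gwp2_agreement // -/q.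
have mean := balanced_mean_agreement C (balanced_pair_design p).
rewrite -/q in mean.
have -> : (\sum_uv combination_count D p uv ^ 2)%N =
    (\sum_i \sum_i' ((D i p.1 == D i' p.1) && (D i p.2 == D i' p.2)))%N.
  have := sum_collisions [set: 'I_N] (fun i => (D i p.1, D i p.2)).
  under eq_bigl do rewrite inE; under eq_bigr do under eq_bigl do rewrite inE.
  under eq_bigr do under eq_bigr do rewrite xpair_eqE.
  move=> ->; apply: eq_bigr => uv _; congr (_ ^ 2)%N.
  by apply: eq_card => i; rewrite !inE -pair_eqE.
have -> : \sum_i \sum_i'
    ((q * (agreement (pair_design D p) i i')%:R - 2%:R) ^+ 2
    - (2%:R + q * (q - 2%:R) * (agreement (pair_design D p) i i')%:R)) =
  2%:R * q ^+ 2 * (\sum_i \sum_i'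
       ((D i p.1 == D i' p.1) && (D i p.2 == D i' p.2)))%N%:R
  - 2%:R * (q * (\sum_i \sum_i' (agreement (pair_design D p) i i')%:R))
  + (2%:R *+ N *+ N) :> C.
  rewrite natr_sum mulrA !mulr_sumr -sumrB (mulrn_sum_ord N (_ *+ N)) -big_split /=.
  apply: eq_bigr => i _.
  rewrite natr_sum !mulr_sumr -sumrB (mulrn_sum_ord N) -big_split /=.
  apply: eq_bigr => i' _.
  rewrite -(sum_agreement C) !big_ord_recl big_ord0 !mxE /=.
  by case: (_ == _); case: (_ == _) => /=; ring.
rewrite mean -mulrnA -[2%:R *+ _]mulr_natr natrM.
by field.
Qed.

Lemma orthogonal_combination p uv : orthogonal_pair D p ->
  (combination_count D p uv * #|F| ^ 2 = N)%N.
Proof.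
move=> /forallP/(_ uv)/forallP h; rewrite -[RHS](sum_combination_count p).
rewrite (eq_bigr (fun=> combination_count D p uv)) => [|uv' _]; last first.
  by rewrite (eqP (h uv')).
by rewrite sum_nat_const card_prod mulnC mulnn.
Qed.

(** The projected A2 is, up to a positive factor, the sum of the squared deviations
    of the combination counts from their mean. *)
Lemma orthogonal_pair_A2 p : orthogonal_pair D p = (projected_A2 c D p == 0).
Proof.
have NC : N%:R != 0 :> C by rewrite pnatr_eq0 -lt0n.
have q0 : q != 0 by rewrite pnatr_eq0 -lt0n card_F_gt0.
(* the sum of squared deviations *)
have E : q ^+ 2 * (\sum_uv ((combination_count D p uv)%:R - N%:R / q ^+ 2) ^+ 2) =
     N%:R ^+ 2 * projected_A2 c D p.
  rewrite projected_A2_combinations.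
  rewrite (eq_bigr (fun uv => (combination_count D p uv ^ 2)%:R
    - 2%:R * N%:R / q ^+ 2 * (combination_count D p uv)%:R + N%:R ^+ 2 / q ^+ 4)).
    rewrite big_split sumrB -!mulr_sumr -!natr_sum sum_combination_count.
    rewrite sumr_const card_prod /=  -[_ *+ (_ * _)]mulr_natr natrM -/q.
    by field; rewrite q0 NC.
  by move=> uv _; rewrite natrX; field.
apply/idP/eqP => [orth|A20].
  apply: (@mulfI _ (N%:R ^+ 2)); first by rewrite expf_neq0.
  rewrite -E mulr0 big1 ?mulr0 // => uv _.
  have := congr1 (fun k => k%:R / q ^+ 2) (orthogonal_combination uv orth).
  rewrite /= natrM natrX -/q mulfK ?expf_neq0 // => ->.
  by rewrite subrr expr0n.
move: E; rewrite A20 mulr0 => /eqP; rewrite mulf_eq0 expf_eq0 (negPf q0) /=.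
rewrite psumr_eq0 => [/allP h|uv _]; last first.
  rewrite -realEsqr rpredB ?rpred_div ?rpredX ?realn //.
have cE uv : (combination_count D p uv)%:R = N%:R / q ^+ 2.
  apply/eqP; rewrite -subr_eq0; have := h uv; rewrite mem_index_enum => /(_ isT).
  by rewrite expf_eq0.
apply/forallP => uv; apply/forallP => uv'.
by rewrite -(eqr_nat C) !cE.
Qed.

Lemma fully_aliased_A2 p : fully_aliased_pair D p -> projected_A2 c D p = q - 1.
Proof.
have NC : N%:R != 0 :> C by rewrite pnatr_eq0 -lt0n.
have q0 : q != 0 by rewrite pnatr_eq0 -lt0n card_F_gt0.
case/andP => /eqP card_supp /forallP h.
rewrite projected_A2_combinations.
have -> : (\sum_uv combination_count D p uv ^ 2 = #|F| * (N %/ #|F|) ^ 2)%N.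
  rewrite (bigID (mem [set uv : F * F | (0 < combination_count D p uv)%N])) /=.
  rewrite [X in (_ + X)%N]big1 ?addn0; last first.
    by move=> uv; rewrite inE lt0n negbK => /eqP->.
  rewrite (eq_bigr (fun=> (N %/ #|F|) ^ 2)%N); last first.
    by move=> uv; rewrite inE => uv0; have := h uv; rewrite uv0 => /eqP->.
  by rewrite sum_nat_const card_supp.
have E := balanced_muln p.1 bD; move: (N %/ _)%N E => r E.
have r0 : r%:R != 0 :> C.
  by rewrite pnatr_eq0 -lt0n; move: N0; rewrite -E muln_gt0 => /andP[].
by rewrite -E !natrM -/q; field; rewrite q0 r0.
Qed.

End Pairs.

(** * Collisions of pairs of columns *)

Section Collisions.
Variables (F : finFieldType) (n : nat) (S : {set F}).
Implicit Types (d x y : 'rV[F]_n.+2) (a t z e : F) (f g : {ffun 'rV[F]_n.+2 -> F}).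

Notation basis_vector := (@basis_vector F n).
Notation normalized := (normalized F n).
Notation pencil := (pencil F n).
Notation tail_normalized := (tail_normalized F n).
Notation design_cols := (design_cols F n).
Notation rows := (design_rows n S).

(** The number of rows with given levels in the columns f and g. *)
Definition cell f g (uv : F * F) : nat :=
  #|[set x in rows | (f x == uv.1) && (g x == uv.2)]|.

(** The number of ordered pairs of rows on which both f and g agree. *)
Definition collisions f g : nat := \sum_uv cell f g uv ^ 2.

Lemma collisionsE f g :
  collisions f g = (\sum_(x in rows) \sum_(y in rows) ((f x == f y) && (g x == g y)))%N.
Proof.
under eq_bigr do under eq_bigr do rewrite -xpair_eqE.
by rewrite sum_collisions; apply: eq_bigr => uv _; congr (_ ^ 2)%N.
Qed.

(** Two distinct columns of the pencil together carry the same information as X_1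
    and the branching column. *)
Lemma pencil_separates f g x y : f \in pencil -> g \in pencil -> f != g ->
  (f x == f y) && (g x == g y) =
  (x 0 0 == y 0 0) && (branching F n x == branching F n y).
Proof.
move=> fP gP fg; apply/andP/andP => [[/eqP fxy /eqP gxy]|[/eqP x0 /eqP xb]]; last first.
  have E h : h \in pencil -> h x = h y.
    by case/pencilP => [->|[a a0 ->]]; rewrite ?quad_basis1 ?X1E ?x0 ?xb.
  by rewrite (E f fP) (E g gP).
move: fg fxy gxy; case/pencilP: fP => [->|[a a0 ->]];
    case/pencilP: gP => [->|[a' a0' ->]]; rewrite ?eqxx // ?quad_basis1 ?X1E.
- by move=> _ -> /addIr ->.
- by move=> _ /[swap] -> /addIr ->.
move=> fg E1 E2; have aa' : a != a' by apply: contraNneq fg => ->.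
have x0 : x 0 0 = y 0 0.
  apply: (@mulfI _ (a - a')); first by rewrite subr_eq0.
  transitivity ((branching F n x + a * x 0 0) - (branching F n x + a' * x 0 0)).
    by ring.
  by rewrite E1 E2; ring.
by move: E1; rewrite x0 => /addIr ->.
Qed.

Lemma pencil_collisions f g : f \in pencil -> g \in pencil -> f != g ->
  collisions f g = (#|S| * #|F| * (#|F| ^ n) ^ 2)%N.
Proof.
move=> fP gP fg; rewrite collisionsE.
under eq_bigr do under eq_bigr do rewrite (pencil_separates _ _ fP gP fg) -xpair_eqE.
rewrite (sum_collisions _ (fun x : 'rV[F]_n.+2 => (x 0 0, branching F n x))).
pose c := fun p : F * F => if p.2 \in S then ((#|F| ^ n) ^ 2)%N else 0%N.
rewrite (eq_bigr c) => [|[t z] _]; last first.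
  rewrite /c /=; case: ifPn => zS; last first.
    apply/eqP; rewrite expn_eq0 andbT cards_eq0; apply/set0Pn => -[x].
    rewrite !inE xpair_eqE => /and3P[xS _ /eqP xz].
    by rewrite -xz xS in zS.
  rewrite -(card_X1_branching n t z); congr (_ ^ 2)%N; apply: eq_card => x.
  rewrite !inE xpair_eqE; case: (x 0 0 =P t) => _; rewrite ?andbF //=.
  by case: (branching F n x =P z) => [->|_]; rewrite ?zS ?andbF.
rewrite -(pair_bigA _ (fun t z => c (t, z))) /c /= sum_nat_const -big_mkcond.
by rewrite sum_nat_const; ring.
Qed.

(** The value of X_2 + e X_1 at a point with X_1 = t and branching level z, as a
    function of (t, z). *)
Definition parabola e (p : F * F) : F := p.2 - p.1 ^+ 2 + e * p.1.

(** The number of collisions of the parabola function with parameter e on the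
    points with branching level in S. *)
Definition twist e : nat :=
  \sum_w #|[set p in setX [set: F] S | parabola e p == w]| ^ 2.

(** The difference of the two columns is b times parabola e, evaluated at X_1 and
    the branching level; on each level set of it, both columns can be translated
    simultaneously, so that only the collisions of the difference matter. *)
Lemma twist_collisions a d (b e : F) : d \in tail_normalized -> b != 0 ->
  (collisions (quad (a, d)) (quad ((a + b * e)%R, (d + b *: basis_vector 1)%R))
     * #|F| ^ 2
   = #|F| * (#|F| ^ n) ^ 2 * twist e)%N.
Proof.
move=> dT b0; have [d0 [i [i1 di _]]] := tail_normalizedP dT.
set f := quad (a, d); set g := quad (a + b * e, d + b *: basis_vector 1).
have s2 : (0 < #|F|)%N := card_F_gt0 F.
pose par x := parabola e (x 0 0, branching F n x).
have gE x : g x = f x + b * par x.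
  rewrite /g /f /par /parabola !quadE linear_formDl linear_formZl.
  by rewrite linear_form_basisl branching_val /=; ring.
pose T w := #|[set p in setX [set: F] S | parabola e p == w]|.
have cardR w : #|[set x in rows | par x == w]| = (#|F| ^ n * T w)%N.
  rewrite mulnC -sum_nat_const -sum1_card.
  rewrite (partition_big (fun x : 'rV[F]_n.+2 => (x 0 0, branching F n x))
      (mem [set p in setX [set: F] S | parabola e p == w])) /=; last first.
    move=> x; rewrite in_set => /andP[xR xw]; rewrite inE in_setX in_setT.
    by move: xR; rewrite inE => -> /=.
  apply: eq_bigr => -[t z]; rewrite inE in_setX in_setT => /andP[/= zS pw].
  rewrite -(card_X1_branching n t z) -sum1_card; apply: eq_bigl => x.
  rewrite !inE xpair_eqE /par.
  case: (x 0 0 =P t) => [->|_]; rewrite ?andbF //=.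
  case: (branching F n x =P z) => [->|_]; rewrite ?andbF //=.
  by rewrite zS pw.
have cellE u w : (cell f g (u, u + b * w)%R * #|F| = #|F| ^ n * T w)%N.
  rewrite -cardR.
  have RS t x : x \in [set x in rows | par x == w] ->
      x + t *: basis_vector i \in [set x in rows | par x == w].
    have /negPf i0 : 0 != i by apply: contraTneq i1 => <-.
    by rewrite !inE /par branching_shift // shiftE i0 mulr0 addr0.
  have di0 : d 0 i != 0 by rewrite di oner_neq0.
  rewrite -(equidistributed_quad a i1 RS di0 u); congr (_ * _)%N.
  apply: eq_card => x; rewrite !inE -/f gE -andbA; congr (_ && _).
  case: (f x =P u) => [->|_]; rewrite ?andbF // andbT.
  by rewrite (inj_eq (addrI u)) (inj_eq (mulfI b0)).
rewrite /collisions -(pair_bigA _ (fun u v => cell f g (u, v) ^ 2)%N) /=.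
rewrite big_distrl /= -mulnA -[X in (X * _)%N]/(#|F|) -sum_nat_const.
apply: eq_bigr => u _.
rewrite (reindex (fun w => u + b * w)) /=; last first.
  exists (fun v => (v - u) / b) => w _; first by rewrite addrC addKr mulrC mulKf.
  by rewrite mulrC divfK // addrC subrK.
rewrite big_distrl /twist big_distrr /=; apply: eq_bigr => w _.
by rewrite -!expnMn cellE.
Qed.

Definition orthogonal_columns f g : Prop :=
  forall uv, (cell f g uv * #|F| ^ 2 = #|rows|)%N.

Lemma orthogonal_columnsC f g : orthogonal_columns f g -> orthogonal_columns g f.
Proof.
move=> h [u v]; rewrite -(h (v, u)); congr (_ * _)%N; apply: eq_card => x.
by rewrite !inE andbC [in RHS]andbC /= -!andbA; do !bool_congr.
Qed.

Lemma orthogonal_collisions f g : orthogonal_columns f g ->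
  (collisions f g * #|F| ^ 2 = #|rows| ^ 2)%N.
Proof.
move=> h; apply/eqP; rewrite -(eqn_pmul2r (_ : 0 < #|F| ^ 2)%N); last first.
  by rewrite expn_gt0 card_F_gt0.
rewrite -mulnA mulnn /collisions big_distrl /=.
under eq_bigr do rewrite -expnMn h.
by rewrite sum_nat_const card_prod mulnn mulnC.
Qed.

End Collisions.

(** * Classification of the pairs of columns *)

Section Classification.
Variables (F : finFieldType) (n : nat) (S : {set F}).
Implicit Types (d x y : 'rV[F]_n.+2) (a t z e b : F) (f g : {ffun 'rV[F]_n.+2 -> F}).

Notation basis_vector := (@basis_vector F n).
Notation normalized := (normalized F n).
Notation pencil := (pencil F n).
Notation tail_normalized := (tail_normalized F n).
Notation design_cols := (design_cols F n).
Notation rows := (design_rows n S).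
Notation orthogonal_columns := (orthogonal_columns S).

(** Two criteria of orthogonality: g is equidistributed on each level set of f, or
    on each level set of f - g. *)
Lemma fiberwise_orthogonal f g : equidistributed rows f ->
  (forall u, equidistributed [set x in rows | f x == u] g) ->
  orthogonal_columns f g.
Proof.
move=> hf hg [u v]; rewrite -(hf u) -(hg u v) -mulnA mulnn; congr (_ * _)%N.
by apply: eq_card => x; rewrite !inE andbA.
Qed.

Lemma difference_orthogonal f g : equidistributed rows (fun x => f x - g x) ->
  (forall w, equidistributed [set x in rows | f x - g x == w] g) ->
  orthogonal_columns f g.
Proof.
move=> hf hg [u v]; rewrite -(hf (u - v)) -(hg (u - v) v) -mulnA mulnn.
congr (_ * _)%N; apply: eq_card => x; rewrite !inE -andbA; congr (_ && _) => /=.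
by case: (g x =P v) => [->|_]; rewrite ?andbF // !andbT (inj_eq (addIr _)).
Qed.

Lemma rows_shift x t (i : 'I_n.+2) : (1 < i)%N -> x \in rows ->
  x + t *: basis_vector i \in rows.
Proof. by move=> i1; rewrite !inE branching_shift. Qed.

Lemma pencil_tail_orthogonal f a d : f \in pencil -> d \in tail_normalized ->
  orthogonal_columns f (quad (a, d)).
Proof.
move=> fP dT; have [_ [i [i1 di _]]] := tail_normalizedP dT.
apply: fiberwise_orthogonal; first exact: equidistributed_pencil.
move=> u; apply: (equidistributed_quad a i1); last by rewrite di oner_neq0.
move=> t x; rewrite in_set => /andP[xR fx].
by rewrite in_set rows_shift // pencil_shift.
Qed.

Lemma last_position_orthogonal a a' d d' (i : 'I_n.+2) : d \in tail_normalized ->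
  (1 < i)%N -> d 0 i = 0 -> d' 0 i = 1 ->
  orthogonal_columns (quad (a, d)) (quad (a', d')).
Proof.
move=> dT i1 di di'; have [_ [j [j1 dj _]]] := tail_normalizedP dT.
apply: fiberwise_orthogonal.
  apply: (equidistributed_quad a j1); last by rewrite dj oner_neq0.
  by move=> t x; exact: rows_shift.
move=> u; apply: (equidistributed_quad a' i1); last by rewrite di' oner_neq0.
move=> t x; rewrite in_set => /andP[xR fx].
by rewrite in_set rows_shift // quad_shift // di mulr0 addr0.
Qed.

Lemma quadB a a' d d' x :
  quad (a, d) x - quad (a', d') x = (a - a') * x 0 0 + linear_form (d - d') x.
Proof. by rewrite !quadE linear_formDl -scaleN1r linear_formZl; ring. Qed.

Lemma same_position_orthogonal a a' d d' (i : 'I_n.+2) :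
  (1 < i)%N -> d 0 i = 1 -> d' 0 i = 1 ->
  equidistributed rows (fun x => (a - a') * x 0 0 + linear_form (d - d') x) ->
  orthogonal_columns (quad (a, d)) (quad (a', d')).
Proof.
move=> i1 di di' E; apply: difference_orthogonal.
  move=> v; rewrite -(E v); congr (_ * _)%N; apply: eq_card => x.
  by rewrite [in LHS]in_set [in RHS]in_set quadB.
move=> w; apply: (equidistributed_quad a' i1); last by rewrite di' oner_neq0.
move=> t x; rewrite in_set => /andP[xR fx]; rewrite in_set rows_shift //.
by rewrite !quad_shift // di di' opprD addrACA subrr addr0.
Qed.

Lemma quad_eqP a a' d d' : d 0 0 = 0 -> d' 0 0 = 0 ->
  quad (a, d) = quad (a', d') -> a = a' /\ d = d'.
Proof.
move=> d0 d0' E; have [] // : (a, d) = (a', d').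
by apply: quad_inj E; rewrite inE /= ?d0 ?d0'.
Qed.

Lemma basis_vector1_0 : basis_vector 1 0 0 = 0.
Proof. by rewrite basis_vectorE. Qed.

(** The pairs of columns, off the pencil, whose linear parts differ by a multiple
    b X_2.  The coefficients of X_1 differ by b e: with this normalization the
    joint distribution depends on the parameter e only. *)
Definition twisted_pair (p : (F * 'rV[F]_n.+2) * (F * F)) :
    {ffun 'rV[F]_n.+2 -> F} * {ffun 'rV[F]_n.+2 -> F} :=
  (quad p.1, quad (p.1.1 + p.2.1 * p.2.2, p.1.2 + p.2.1 *: basis_vector 1)).

(** The twisted pairs with parameter in E. *)
Definition twisted_pairs (E : {set F}) :=
  twisted_pair @: setX (setX [set: F] tail_normalized) (setX [set~ 0] E).

Lemma twisted_pairsP (E : {set F}) f g : reflect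
  (exists a d b e, [/\ d \in tail_normalized, b != 0, e \in E,
     f = quad (a, d) & g = quad (a + b * e, d + b *: basis_vector 1)])
  ((f, g) \in twisted_pairs E).
Proof.
apply: (iffP imsetP) => [[[[a d] [b e]]]|[a [d [b [e [dT b0 eE -> ->]]]]]].
  rewrite !in_setX in_setT in_setC1 => /andP[/= dT /andP[b0 eE]] [-> ->].
  by exists a, d, b, e.
by exists ((a, d), (b, e)) => //; rewrite !in_setX in_setT in_setC1 dT b0.
Qed.

Lemma tail_normalized_add d b : d \in tail_normalized ->
  d + b *: basis_vector 1 \in tail_normalized.
Proof.
move=> dT; have [d0 [i [i1 di dj]]] := tail_normalizedP dT.
have i1' : (i == 1) = false by apply: contraTF i1 => /eqP ->.
have E : (d + b *: basis_vector 1) 0 i = 1 by rewrite shiftE i1' mulr0 addr0.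
rewrite in_setD1; apply/andP; split.
  apply: contra_eq_neq E => ->; rewrite basis_vectorE i1'.
  by rewrite eq_sym oner_neq0.
apply/normalizedP; split; first by rewrite shiftE d0 mulr0 addr0.
exists i => // j ij; rewrite shiftE dj // add0r.
have /negPf-> : j != 1 by apply: contraTneq (ltn_trans i1 ij) => ->.
by rewrite mulr0.
Qed.

(** If the last nonzero positions i of d and i' of d' differ, the later one
    shifts only one column.  If they coincide, shifting there moves both columns
    together, and it remains to shift the difference: along another coordinate
    beyond X_2, or along X_1 when d = d'.  Neither is possible only when d - d' is
    a nonzero multiple of X_2. *)
Lemma column_pair_cases f g : f \in design_cols -> g \in design_cols -> f != g ->
  [\/ f \in pencil /\ g \in pencil, (f, g) \in twisted_pairs [set: F] |
      orthogonal_columns f g].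
Proof.
case/design_colsP => [fP|[a [d dT fE]]]; case/design_colsP => [gP|[a' [d' dT' gE]]].
- by move=> _; apply: Or31.
- by move=> _; apply: Or33; rewrite gE; exact: pencil_tail_orthogonal.
- move=> _; apply: Or33; apply: orthogonal_columnsC; rewrite fE.
  exact: pencil_tail_orthogonal.
rewrite {}fE {}gE => fg.
have [d0 [i [i1 di dj]]] := tail_normalizedP dT.
have [d0' [i' [i1' di' dj']]] := tail_normalizedP dT'.
have [ii'|i'i|ii'] := ltngtP i i'.
- by apply: Or33; apply: (last_position_orthogonal a a' dT i1' (dj _ ii') di').
- apply: Or33; apply: orthogonal_columnsC.
  by apply: (last_position_orthogonal a' a dT' i1 (dj' _ i'i) di).
have {}ii' : i' = i by apply: val_inj.
rewrite {}ii' in di' dj' {i1'}.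
case: (boolP [exists j : 'I_n.+2, (1 < j)%N && (d 0 j != d' 0 j)]) => [|/existsPn h].
  case/existsP => j /andP[j1 djj]; apply: Or33.
  apply: (same_position_orthogonal i1 di di').
  have nz : (d - d') 0 j != 0 by rewrite !mxE subr_eq0.
  have /negPf j0 : 0 != j by apply: contraTneq j1 => <-.
  apply: (@equidistributed_shift _ _ _ _
     (fun t x => x + (t / (d - d') 0 j) *: basis_vector j)).
  - by move=> t; exact: addIr.
  - by move=> t x; exact: rows_shift.
  - by move=> t x _; rewrite linear_form_add shiftE j0 mulr0 addr0 divfK // addrA.
have dd' : d' = d + (d' 0 1 - d 0 1) *: basis_vector 1.
  apply/rowP => j; rewrite shiftE; have := h j; rewrite negb_and negbK.
  have [->|j0] := eqVneq j 0; first by rewrite d0 d0' mulr0 addr0.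
  have [->|j1] := eqVneq j 1; first by rewrite mulr1 addrC subrK.
  case/orP => [|/eqP->]; last by rewrite mulr0 addr0.
  by case: j j0 j1 => -[|[|j]].
have [b0|b0] := eqVneq (d' 0 1 - d 0 1) 0.
  have {}dd' : d' = d by rewrite dd' b0 scale0r addr0.
  rewrite {}dd' in fg di' dj' dT' d0' h b0 *.
  have aa : a - a' != 0 by rewrite subr_eq0; apply: contraNneq fg => ->.
  apply: Or33; apply: (same_position_orthogonal i1 di di).
  have lf0 x : linear_form (d - d) x = 0.
    by rewrite subrr ffunE big1 // => j _; rewrite mxE mul0r.
  apply: (@equidistributed_shift _ _ _ _ (fun t => level_shift (t / (a - a')))).
  - by move=> t; exact: level_shift_inj.
  - by move=> t x; rewrite !inE branching_level_shift.
  - by move=> t x _; rewrite !lf0 level_shiftE; field.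
apply: Or32; apply/twisted_pairsP.
exists a, d, (d' 0 1 - d 0 1), ((a' - a) / (d' 0 1 - d 0 1)).
split=> //.
by rewrite -dd'; congr (quad (_, _)); field.
Qed.

Lemma twisted_pairs_cols E f g : (f, g) \in twisted_pairs E ->
  [/\ f \in design_cols, g \in design_cols & f != g].
Proof.
have qc a d : d \in tail_normalized -> quad (a, d) \in design_cols.
  rewrite in_setD1 in_setD1 => /andP[d1 dn]; rewrite Q1E in_setU1 imset_f ?orbT.
    rewrite andbT branchingE; apply: contra_neq d1 => E'.
    by have [d0 _] := normalizedP _ dn; have [_ ->] := quad_eqP d0 basis_vector1_0 E'.
  by rewrite in_setX in_setT.
case/twisted_pairsP => a [d [b [e [dT b0 _ -> ->]]]].
split; [exact: qc|by apply: qc; exact: tail_normalized_add|].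
have [d0 _] := tail_normalizedP dT.
have d0' : (d + b *: basis_vector 1) 0 0 = 0 by rewrite shiftE d0 mulr0 addr0.
apply: contra_neq b0 => /(quad_eqP d0 d0')[_ /rowP/(_ 1)].
rewrite shiftE eqxx mulr1 => /eqP; rewrite -subr_eq0 opprD addNKr oppr_eq0.
by move/eqP.
Qed.

Lemma twisted_not_pencil E f g : (f, g) \in twisted_pairs E -> f \notin pencil.
Proof.
case/twisted_pairsP => a [d [b [e [dT b0 _ -> _]]]].
have [d0 _] := tail_normalizedP dT; move: dT; rewrite in_setD1 => /andP[d1 dn].
apply/negP => /pencilP[/eqP|[a' a0 E']]; first by rewrite (negPf (quad_neq_X1 _ dn)).
by have [_ E1] := quad_eqP d0 basis_vector1_0 E'; rewrite E1 eqxx in d1.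
Qed.

Lemma twisted_pairsC E f g : (f, g) \in twisted_pairs E -> (g, f) \in twisted_pairs E.
Proof.
case/twisted_pairsP => a [d [b [e [dT b0 eE -> ->]]]]; apply/twisted_pairsP.
exists (a + b * e), (d + b *: basis_vector 1), (- b), e; split=> //.
- exact: tail_normalized_add.
- by rewrite oppr_eq0.
- by congr (quad (_, _)); rewrite ?scaleNr ?addrK // mulNr addrK.
Qed.

Lemma card_tail_normalized : ((#|F| - 1) * #|tail_normalized| + #|F| = #|F| ^ n.+1)%N.
Proof.
rewrite -card_normalized; have := cardsD1 (basis_vector 1) normalized.
rewrite basis1_normalized => ->; rewrite -/tail_normalized.
have := card_F_gt1 F; set s := #|F|; set u := #|_|; case: s => // s _.
by rewrite subn1 /=; nia.
Qed.

Lemma card_twisted_pairs E :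
  #|twisted_pairs E| = (#|F| * #|tail_normalized| * ((#|F| - 1) * #|E|))%N.
Proof.
rewrite card_in_imset ?cardsX ?cardsT ?cardsC1 ?subn1 //.
move=> p p'; case: p => -[a d] [b e]; case: p' => -[a' d'] [b' e'].
rewrite !in_setX !in_setC1 => /and3P[/= /andP[_ dT] b0 _].
move=> /and3P[/= /andP[_ dT'] b0' _].
have [d0 _] := tail_normalizedP dT; have [d0' _] := tail_normalizedP dT'.
rewrite /twisted_pair => -[/= E1 E2].
have [aa' dd'] := quad_eqP d0 d0' E1.
have := quad_eqP _ _ E2; rewrite !shiftE d0 d0' !mulr0 !addr0 => /(_ erefl erefl)[].
rewrite -aa' -dd' => /addrI be /addrI /rowP/(_ 1).
rewrite !mxE eqxx !mulr1 => bb'; rewrite -bb' in be *.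
by rewrite (mulfI b0 be).
Qed.

End Classification.

(** * Twist counts *)

(** Lagrange in one direction, Cauchy in the other, in the additive group of F. *)
Lemma two_eq0_odd_card (F : finFieldType) : (2%:R == 0 :> F) = ~~ odd #|F|.
Proof.
apply/eqP/idP => [two0|ev].
  have o1 : #[1%R : F]%g != 1%N by rewrite order_eq1 FinRing.zmod1gE oner_eq0.
  have o2 : (#[1%R : F]%g %| 2)%N by rewrite order_dvdn FinRing.zmodXgE two0.
  have /eqP o12 : #[1%R : F]%g == 2%N by move: o2; rewrite dvdn_divisors // !inE (negPf o1).
  by rewrite -dvdn2 -cardsT -o12 order_dvdG ?inE.
have [|x _ ox] := @Cauchy F 2 [group of [set: F]] isT; first by rewrite cardsT dvdn2.
have x0 : x != 0 by rewrite -FinRing.zmod1gE -order_eq1 ox.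
apply: (mulIf x0); rewrite mul0r mulr_natl -FinRing.zmodXgE -FinRing.zmod1gE -ox.
exact: expg_order.
Qed.

Section Twist.
Variables (F : finFieldType) (S : {set F}).
Implicit Types (e y z : F).

(** The points (t, t') such that parabola e takes the same value at (t, z) and
    (t', z') when z - z' = y. *)
Definition twist_fiber e y : {set F * F} :=
  [set p : F * F | (p.1 - p.2) * (p.1 + p.2 - e) == y].

Lemma twistE e :
  twist S e = (\sum_(z in S) \sum_(z' in S) #|twist_fiber e (z - z')%R|)%N.
Proof.
have sumX (G : F * F -> nat) :
    (\sum_(p in setX [set: F] S) G p = \sum_(z in S) \sum_t G (t, z))%N.
  rewrite exchange_big pair_big /=; apply: eq_big => -[t z] //=.
  by rewrite in_setX in_setT.
rewrite /twist -sum_collisions sumX; apply: eq_bigr => z _.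
under eq_bigr do rewrite sumX; rewrite exchange_big; apply: eq_bigr => z' _.
rewrite pair_big /= -sum1_card [RHS]big_mkcond; apply: eq_bigr => -[t t'] _ /=.
rewrite inE /parabola /= -subr_eq0 -[in RHS]subr_eq0 -[in RHS]oppr_eq0.
have -> : - ((t - t') * (t + t' - e) - (z - z')) =
  z - t ^+ 2 + e * t - (z' - t' ^+ 2 + e * t') by ring.
by case: eqP.
Qed.

(** In odd characteristic, t - t' and t + t' - e are free coordinates, and the
    fibers are the level sets of a product. *)
Lemma twist_odd e : odd #|F| ->
  twist S e = (#|S| * (2 * #|F| - 1) + #|S| * (#|S| - 1) * (#|F| - 1))%N.
Proof.
move=> oddF; have two0 : 2%:R != 0 :> F by rewrite two_eq0_odd_card negbK.
have cardF y : #|twist_fiber e y| = #|[set p : F * F | p.1 * p.2 == y]|.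
  pose h (p : F * F) := (p.1 - p.2, p.1 + p.2 - e).
  pose h' (p : F * F) := ((p.1 + p.2 + e) / 2%:R, (p.2 + e - p.1) / 2%:R).
  have hK : cancel h h' by case=> t t'; rewrite /h /h' /=; congr (_, _); field.
  have h'K : cancel h' h by case=> t t'; rewrite /h /h' /=; congr (_, _); field.
  rewrite -[LHS](card_imset _ (can_inj hK)); apply: eq_card => p.
  apply/imsetP/idP => [[p' /[!inE] Ep' ->] //|].
  by rewrite inE => Ep; exists (h' p); rewrite ?h'K // inE -[_ * _]/((h (h' p)).1 * (h (h' p)).2) h'K.
have card0 : #|[set p : F * F | p.1 * p.2 == 0%R]| = (2 * #|F| - 1)%N.
  have -> : [set p : F * F | p.1 * p.2 == 0] =
      setX [set 0] [set: F] :|: setX [set: F] [set 0].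
    by apply/setP => -[t t']; rewrite in_set in_setU !in_setX !in_set1 !in_setT mulf_eq0 andbT.
  rewrite cardsU !cardsX cards1 cardsT mul1n muln1 addnn -mul2n; congr (_ - _)%N.
  have -> : setX [set 0] [set: F] :&: setX [set: F] [set 0] = [set (0, 0)].
    apply/setP => -[t t'].
    by rewrite in_setI !in_setX !in_set1 !in_setT andbT xpair_eqE.
  by rewrite cards1.
have cardn0 y : y != 0 -> #|[set p : F * F | p.1 * p.2 == y]| = (#|F| - 1)%N.
  move=> y0; rewrite subn1 -(cardsC1 (0 : F)).
  have inj : injective (fun t : F => (t, y / t)) by move=> t t' [].
  rewrite -[RHS](card_imset _ inj); apply: eq_card => -[t t'].
  rewrite in_set /=; apply/eqP/imsetP => [E|[u]]; last first.
    by rewrite in_setC1 => u0 [-> ->]; rewrite mulrC divfK.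
  have t0 : t != 0 by apply: contra_eq_neq E => ->; rewrite mul0r eq_sym.
  by exists t; rewrite ?in_setC1 // -E mulrAC mulfV // mul1r.
rewrite twistE -mulnA -mulnDr -sum_nat_const; apply: eq_bigr => z zS.
rewrite (bigD1 z) //= cardF subrr card0; congr (_ + _)%N.
have -> : (#|S| - 1 = #|S :\ z|)%N by rewrite (cardsD1 z S) zS addKn.
rewrite -sum_nat_const; apply: eq_big => [z'|z' /andP[_ zz']].
  by rewrite in_setD1 andbC.
by rewrite cardF cardn0 // subr_eq0 eq_sym.
Qed.

(** In characteristic 2, t + t' = t - t', so that a fiber is described by the
    difference t - t' alone. *)
Definition even_fiber e y : {set F} := [set t | t * (t - e) == y].

Lemma card_twist_fiber_even e y : ~~ odd #|F| ->
  #|twist_fiber e y| = (#|F| * #|even_fiber e y|)%N.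
Proof.
rewrite -two_eq0_odd_card => /eqP two0.
have opp (t : F) : - t = t.
  by apply/esym/eqP; rewrite -addr_eq0 -mulr2n -mulr_natl two0 mul0r.
pose h (p : F * F) := (p.2, p.1 - p.2).
have hK : injective h by move=> [t u] [t' u'] [-> /addIr ->].
rewrite -cardsT -cardsX -[LHS](card_imset _ hK); apply: eq_card => -[t u].
rewrite in_setX in_setT [RHS]in_set; apply/imsetP/eqP => [[[v w]]|E].
  by rewrite in_set => /eqP /= <- [_ ->]; rewrite opp.
exists (u + t, t); last by rewrite /h /= addrK.
rewrite in_set /= addrK -E; apply/eqP; congr (_ * (_ - _)).
by rewrite -addrA -mulr2n -mulr_natl two0 mul0r addr0.
Qed.

Lemma even_fiber_sub e y t : t \in even_fiber e y ->
  even_fiber e y = [set t; e - t].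
Proof.
rewrite inE => /eqP <-; apply/setP => u; rewrite !inE -subr_eq0.
have -> : u * (u - e) - t * (t - e) = (u - t) * (u - (e - t)) by ring.
by rewrite mulf_eq0 !subr_eq0.
Qed.

Lemma card_even_fiber_le2 e y : (#|even_fiber e y| <= 2)%N.
Proof.
have [->|[t ty]] := set_0Vmem (even_fiber e y); first by rewrite cards0.
by rewrite (even_fiber_sub ty) cards2; case: (_ != _).
Qed.

Lemma twist_even e : ~~ odd #|F| ->
  twist S e = (#|F| * \sum_(z in S) \sum_(z' in S) #|even_fiber e (z - z')%R|)%N.
Proof.
move=> ev; rewrite twistE big_distrr; apply: eq_bigr => z _.
by rewrite big_distrr; apply: eq_bigr => z' _; rewrite card_twist_fiber_even.
Qed.

Lemma twist_even_le e : ~~ odd #|F| -> (twist S e <= #|F| * (#|S| ^ 2 * 2))%N.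
Proof.
move=> ev; rewrite twist_even // leq_pmul2l ?card_F_gt0 //.
rewrite -mulnn -mulnA -sum_nat_const; apply: leq_sum => z _.
by rewrite -sum_nat_const; apply: leq_sum => z' _; exact: card_even_fiber_le2.
Qed.

Lemma twist_even0 : ~~ odd #|F| -> twist S 0 = (#|F| * #|S| ^ 2)%N.
Proof.
move=> ev; rewrite twist_even // -mulnn -sum_nat_const; congr (_ * _)%N.
apply: eq_bigr => z _; rewrite -sum1_card; apply: eq_bigr => z' _.
have two0 : 2%:R = 0 :> F by apply/eqP; rewrite two_eq0_odd_card.
have sq_inj : injective (fun t : F => t ^+ 2).
  move=> t u /= E; apply/eqP; rewrite -subr_eq0 -sqrf_eq0.
  have -> : (t - u) ^+ 2 = (t ^+ 2 - u ^+ 2) + 2%:R * (u ^+ 2 - t * u) by ring.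
  by rewrite E subrr two0 mul0r addr0.
rewrite -(cards1 (invF sq_inj (z - z'))); apply: eq_card => t.
have /= inv_sq := f_invF sq_inj (z - z').
by rewrite !inE subr0 -expr2 -[RHS](inj_eq sq_inj) /= inv_sq.
Qed.

(** With 4 elements, t (t - e) is 0 on {0, e} and e^2 on the two other points, as
    all cubes of nonzero elements are 1. *)
Lemma card_even_fiber4 e y : #|F| = 4%N -> e != 0 ->
  #|even_fiber e y| = (((y == 0%R) || (y == (e ^+ 2)%R)) * 2)%N.
Proof.
move=> F4 e0.
have two0 : 2%:R = 0 :> F by apply/eqP; rewrite two_eq0_odd_card F4.
have cube (t : F) : t != 0 -> t ^+ 3 = 1.
  move=> t0; apply: (mulfI t0); rewrite mulr1 -exprS.
  by have := expf_card t; rewrite F4.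
have ee (t : F) : t * (t - e) = 0 \/ t * (t - e) = e ^+ 2.
  have [->|t0] := eqVneq t 0; first by left; rewrite mul0r.
  have [->|te] := eqVneq t e; first by left; rewrite subrr mulr0.
  right; have te0 : t - e != 0 by rewrite subr_eq0.
  apply: (mulfI te0); apply/eqP; rewrite -subr_eq0.
  have -> : (t - e) * (t * (t - e)) - (t - e) * e ^+ 2
     = (t ^+ 3 - e ^+ 3) - 2%:R * (t - e) * (t * e + e ^+ 2)  by ring.
  by rewrite !cube // two0 !mul0r !subrr.
have card2 y' t : t \in even_fiber e y' -> #|even_fiber e y'| = 2%N.
  move=> ty; rewrite (even_fiber_sub ty) cards2.
  suff -> : t != e - t by [].
  apply: contraNneq e0 => E.
  by rewrite -(subrK t e) -E -mulr2n -mulr_natl two0 mul0r.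
case: (y =P 0) => [->|/eqP y0] /=; first by apply: (card2 _ 0); rewrite inE mul0r.
case: (y =P e ^+ 2) => [->|/eqP ye] /=; last first.
  apply/eqP; rewrite cards_eq0; apply/set0Pn => -[t]; rewrite inE => /eqP E.
  by case: (ee t); rewrite E => E'; rewrite E' eqxx in y0 ye.
have [t] : exists t, t \notin [set 0; e].
  apply/existsP; apply: contraT => /existsPn h.
  have : (#|F| <= #|[set 0%R; e]|)%N.
    by rewrite -cardsT; apply/subset_leq_card/subsetP => t _; have := h t; rewrite negbK.
  by rewrite F4 cards2; case: (_ != _).
rewrite !inE negb_or => /andP[t0 te]; apply: (card2 _ t); rewrite inE.
case: (ee t) => [/eqP|->] //.
by rewrite mulf_eq0 (negPf t0) subr_eq0 (negPf te).
Qed.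

Lemma twist4 e : #|F| = 4%N -> e != 0 ->
  twist S e = (8 * (#|S| + #|[set z in S | (z - e ^+ 2)%R \in S]|))%N.
Proof.
move=> F4 e0; rewrite twist_even ?F4 // -[8%N]/(4 * 2)%N -mulnA; congr (_ * _)%N.
rewrite mulnC mulnDl -sum_nat_const.
have -> : (#|[set z in S | (z - e ^+ 2)%R \in S]| * 2 =
           \sum_(z in S) ((z - e ^+ 2)%R \in S) * 2)%N.
  rewrite -big_distrl /= -sum1_card big_mkcond [in RHS]big_mkcond /=.
  by congr (_ * _)%N; apply: eq_bigr => z _; rewrite inE; case: (z \in S); case: (_ \in S).
rewrite -big_split; apply: eq_bigr => z zS /=.
have e20 : e ^+ 2 != 0 by rewrite expf_neq0.
have indicator u : (\sum_(z' in S) (z' == u) * 2 = (u \in S) * 2)%N.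
  rewrite -big_distrl /=; congr (_ * _)%N; rewrite big_mkcond (bigD1 u) //= eqxx.
  rewrite big1 ?addn0 => [|z' /negPf->]; first by case: (u \in S).
  by case: (z' \in S).
rewrite (eq_bigr (fun z' => (z' == z) * 2 + (z' == (z - e ^+ 2)%R) * 2)%N).
  by rewrite big_split /= !indicator zS.
move=> z' _; rewrite card_even_fiber4 // subr_eq0 (eq_sym z).
have -> : (z - z' == e ^+ 2) = (z' == z - e ^+ 2).
  by apply/eqP/eqP => [<-|->]; rewrite opprB addrC subrK.
case: (z' =P z) => [->|_] //=.
have /negPf-> // : z != z - e ^+ 2.
by rewrite eq_sym -subr_eq0 addrAC subrr add0r oppr_eq0.
Qed.

End Twist.

(** * Projected A2 values and numbers of pairs *)

(** A symmetric set of ordered pairs of distinct elements of A counts each unordered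
    pair twice. *)
Lemma card_increasing_pairs (T : finType) (A : {set T}) (W : {set T * T}) :
  (forall x y, (x, y) \in W -> [/\ x \in A, y \in A & x != y]) ->
  (forall x y, (x, y) \in W -> (y, x) \in W) ->
  (2 * #|[set p in column_pairs #|A| | (enum_val p.1, enum_val p.2) \in W]| = #|W|)%N.
Proof.
move=> WA Wsym; pose ev (p : 'I_#|A| * 'I_#|A|) := (enum_val p.1, enum_val p.2) : T * T.
pose sw (p : 'I_#|A| * 'I_#|A|) := (p.2, p.1).
have sw_inj : injective sw by move=> [i j] [i' j'] [-> ->].
have ev_inj : injective ev by move=> [i j] [i' j'] [/enum_val_inj -> /enum_val_inj ->].
set L := [set p in _ | _].
have -> : #|W| = #|[set p | ev p \in W]|.
  rewrite -(card_imset _ ev_inj); apply: eq_card => -[x y]; apply/idP/imsetP => [xyW|].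
    have [xA yA _] := WA _ _ xyW.
    exists (enum_rank_in xA x, enum_rank_in yA y); first by rewrite inE /ev !enum_rankK_in.
    by rewrite /ev !enum_rankK_in.
  by case=> p /[!inE] pW ->.
rewrite -[RHS](cardsID (column_pairs #|A|)) mul2n -addnn; congr (_ + _)%N.
  by apply: eq_card => p; rewrite !inE andbC.
rewrite -[LHS](card_imset _ sw_inj); apply: eq_card => -[i j].
rewrite !inE /=; apply/imsetP/andP => [[[i' j']]|[ij ijW]].
  rewrite !inE /= => /andP[lt_ij /Wsym ijW] [-> ->].
  by rewrite -leqNgt ltnW.
have [_ _ nij] := WA _ _ ijW; exists (j, i) => //; rewrite !inE /= Wsym // andbT.
rewrite ltn_neqAle leqNgt ij andbT; apply: contraNneq nij => /val_inj ->.
exact: eqxx.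
Qed.

Section Assembly.
Variables (F : finFieldType) (C : numClosedFieldType).
Variables (c : 'I_(#|F|.-1) -> F -> C) (hc : orthonormal_contrasts c).
Variables (n : nat) (S : {set F}) (S0 : (0 < #|S|)%N).
Implicit Types (e : F) (f g : {ffun 'rV[F]_n.+2 -> F}).

Notation D := (juxtaposition n S).
Notation pencil := (pencil F n).
Notation m := #|Q1 F n :\ branching F n|.
Notation A2 := (projected_A2 c D).

Let q : C := #|F|%:R.
Let k : C := #|S|%:R.

(** The columns, as functions, with the given indices. *)
Definition column_pair (p : 'I_m * 'I_m) := (enum_val p.1, enum_val p.2).

Let q0 : q != 0. Proof. by rewrite pnatr_eq0 -lt0n card_F_gt0. Qed.
Let k0 : k != 0. Proof. by rewrite pnatr_eq0 -lt0n. Qed.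
Let Qn0 : q ^+ n != 0. Proof. by rewrite expf_neq0. Qed.
Let N0 : (0 < #|design_rows n S|)%N.
Proof. by rewrite card_design_rows muln_gt0 S0 expn_gt0 card_F_gt0. Qed.
Let NE : #|design_rows n S|%:R = k * q ^+ n.+1 :> C.
Proof. by rewrite card_design_rows natrM natrX. Qed.

Lemma A2_collisions p :
  A2 p = (collisions S (column_pair p).1 (column_pair p).2)%:R
           / (k ^+ 2 * q ^+ (2 * n)) - 1.
Proof.
rewrite (projected_A2_combinations hc (balanced_juxtaposition n S) N0) NE -/q.
have -> : (\sum_uv combination_count D p uv ^ 2)%N =
    collisions S (column_pair p).1 (column_pair p).2.
  apply: eq_bigr => uv _; congr (_ ^ 2)%N; rewrite /cell /design_rows.
  rewrite -(card_enum_pred _ (fun x => ((column_pair p).1 x == uv.1) &&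
    ((column_pair p).2 x == uv.2))).
  by apply: eq_card => i; rewrite !inE !juxtaposition_val.
rewrite (mulnC 2) exprM [q ^+ n.+1]exprS.
by move: Qn0; move: (q ^+ n) => Q Q0; field; rewrite k0 q0 Q0.
Qed.

(** Ordered pairs of distinct columns of the pencil. *)
Definition pencil_pairs : {set {ffun 'rV[F]_n.+2 -> F} * {ffun 'rV[F]_n.+2 -> F}} :=
  [set fg in setX pencil pencil | fg.1 != fg.2].

Lemma pencil_pairsP f g :
  ((f, g) \in pencil_pairs) = [&& f \in pencil, g \in pencil & f != g].
Proof. by rewrite in_set in_setX /= -andbA. Qed.

Lemma pencil_cols f : f \in pencil -> f \in design_cols F n.
Proof.
case/pencilP => [->|[a a0 ->]]; rewrite in_setD1 Q1E in_setU1 branchingE.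
  by rewrite eqxx eq_sym quad_neq_X1 ?basis1_normalized.
rewrite imset_f ?orbT ?andbT ?in_setX ?in_setT ?basis1_normalized //.
by apply: contra_neq a0 => /quad_eqP[] //; exact: basis_vector1_0.
Qed.

Lemma card_pencil : #|pencil| = #|F|.
Proof.
rewrite cardsU1 card_imset; last first.
  by move=> a a' /quad_eqP[] //; exact: basis_vector1_0.
rewrite cardsC1 [_ \notin _](_ : _ = true) ?add1n ?prednK ?card_F_gt0 //.
apply/imsetP => -[a _ E]; have := quad_neq_X1 a (basis1_normalized F n).
by rewrite E eqxx.
Qed.

Lemma card_pencil_pairs : #|pencil_pairs| = (#|F| * (#|F| - 1))%N.
Proof.
rewrite -card_pencil -sum_nat_const -sum1_card.
rewrite (partition_big fst (mem pencil)) => [|[f g]]; last first.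
  by rewrite pencil_pairsP => /and3P[].
apply: eq_bigr => f; rewrite inE => fP.
have -> : (#|pencil| - 1 = #|pencil :\ f|)%N.
  by rewrite (cardsD1 f pencil) fP addKn.
have inj : injective (fun g => (f, g)) by move=> g g' [].
rewrite -[RHS](card_imset _ inj) -sum1_card; apply: eq_bigl => -[f' g] /=.
rewrite pencil_pairsP; apply/andP/imsetP => [[/and3P[fP' gP fg] /eqP E]|[g']].
  by exists g; rewrite ?in_setD1 -?E 1?eq_sym ?fg.
rewrite in_setD1 => /andP[g'f g'P] [-> ->]; split=> //.
by rewrite fP g'P eq_sym.
Qed.

Lemma A2_pencil p : column_pair p \in pencil_pairs -> A2 p = (q - k) / k.
Proof.
rewrite A2_collisions; case: (column_pair p) => f g.
rewrite pencil_pairsP => /and3P[fP gP fg] /=.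
rewrite pencil_collisions // !natrM !natrX (mulnC 2) exprM -/q -/k.
by move: Qn0; move: (q ^+ n) => Q Q0; field; rewrite k0 Q0.
Qed.

Lemma A2_twisted p (E : {set F}) : column_pair p \in twisted_pairs n E ->
  exists2 e, e \in E & A2 p = (twist S e)%:R / (q * k ^+ 2) - 1.
Proof.
rewrite A2_collisions; case: (column_pair p) => f g.
case/twisted_pairsP => a [d [b [e [dT b0 eE -> ->]]]]; exists e => //=.
have := congr1 (fun j => j%:R : C) (twist_collisions S a e dT b0).
rewrite /= !natrM natrX -/q => E1.
congr (_ - 1); apply: (@mulIf _ (q ^+ 2)); first by rewrite expf_neq0.
rewrite mulrAC E1 (mulnC 2) exprM.
by move: Qn0; move: (q ^+ n) => Q Q0; field; rewrite q0 k0 Q0.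
Qed.

Lemma A2_orthogonal p :
  orthogonal_columns S (column_pair p).1 (column_pair p).2 -> A2 p = 0.
Proof.
move/orthogonal_collisions => /(congr1 (fun j => j%:R : C)).
rewrite natrM !natrX NE -/q => E1; rewrite A2_collisions.
apply: (@mulIf _ (q ^+ 2)); first by rewrite expf_neq0.
rewrite mulrBl mulrAC E1 [q ^+ n.+1]exprS (mulnC 2) exprM mul0r.
by move: Qn0; move: (q ^+ n) => Q Q0; field; rewrite k0 Q0.
Qed.

Lemma A2_cases p : p \in column_pairs m ->
  [\/ column_pair p \in pencil_pairs, column_pair p \in twisted_pairs n [set: F] |
      A2 p = 0].
Proof.
rewrite inE => lt12.
have ne : enum_val p.1 != enum_val p.2.
  by rewrite (inj_eq enum_val_inj) -val_eqE /= neq_ltn lt12.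
have [[fP gP]|tw|/A2_orthogonal orth] :=
    column_pair_cases S (enum_valP p.1) (enum_valP p.2) ne.
- by apply: Or31; rewrite pencil_pairsP fP gP.
- exact: Or32.
- exact: Or33.
Qed.

Lemma nonorthogonalE p : (p \in nonorthogonal_pairs D) =
  (p \in column_pairs m) && (A2 p != 0).
Proof.
by rewrite in_set (orthogonal_pair_A2 hc (balanced_juxtaposition n S) N0).
Qed.

(** Unordered pairs of columns of the pencil, and unordered twisted pairs with
    parameter in E, in terms of column indices. *)
Definition pencil_index_pairs : {set 'I_m * 'I_m} :=
  [set p in column_pairs m | column_pair p \in pencil_pairs].

Definition twisted_index_pairs (E : {set F}) : {set 'I_m * 'I_m} :=
  [set p in column_pairs m | column_pair p \in twisted_pairs n E].

Lemma card_pencil_index_pairs :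
  (2 * #|pencil_index_pairs| = #|F| * (#|F| - 1))%N.
Proof.
rewrite -card_pencil_pairs; apply: card_increasing_pairs => f g.
  by rewrite pencil_pairsP => /and3P[fP gP]; rewrite !pencil_cols.
by rewrite !pencil_pairsP eq_sym => /and3P[-> ->].
Qed.

Lemma card_twisted_index_pairs (E : {set F}) :
  (2 * #|twisted_index_pairs E| = #|E| * (#|F| ^ n.+2 - #|F| ^ 2))%N.
Proof.
transitivity #|twisted_pairs n E|.
  apply: card_increasing_pairs => f g; first exact: twisted_pairs_cols.
  exact: twisted_pairsC.
rewrite card_twisted_pairs expnS -(card_tail_normalized F n) mulnDr mulnn addnK.
by ring.
Qed.

Lemma disjoint_index_pairs (E : {set F}) :
  [disjoint pencil_index_pairs & twisted_index_pairs E].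
Proof.
rewrite -setI_eq0; apply/set0Pn => -[p]; rewrite in_setI => /andP[].
rewrite in_set => /andP[_]; rewrite pencil_pairsP => /and3P[fP _ _].
by rewrite in_set => /andP[_ /twisted_not_pencil]; rewrite fP.
Qed.

End Assembly.

(** * Overall and projected A2 of the juxtaposition *)

Lemma half_of_double (x y : nat) : (2 * x = y)%N -> x = (y %/ 2)%N.
Proof. by move=> <-; rewrite mulKn. Qed.

Lemma near_constant_gwp2 (F : finFieldType) (C : numClosedFieldType)
    (c : 'I_(#|F|.-1) -> F -> C) (l N m : nat) (D : 'M[F]_(N, m)) :
  orthonormal_contrasts c -> balanced D -> near_constant l D -> (0 < N)%N ->
  let q := #|F|%:R : C in
  gwp c 2 D *+ 2 = q ^+ 2 * (m%:R - l%:R) * (m%:R - l%:R - 1) / N%:R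
    + (2%:R * q * m%:R * l%:R - m%:R ^+ 2 + m%:R - q ^+ 2 * l%:R * (l%:R + 1)).
Proof.
move=> hc bD ncD N0 q; have NC : N%:R != 0 :> C by rewrite pnatr_eq0 -lt0n.
rewrite (gwp2_gap l hc bD N0) sum_gap (near_constantP _ _ ncD) addn0 natrM natr_gap.
by rewrite -/q; congr (_ + _); field.
Qed.

Section Conclusions.
Variables (F : finFieldType) (C : numClosedFieldType).
Variables (c : 'I_(#|F|.-1) -> F -> C) (hc : orthonormal_contrasts c).
Variables (n : nat) (S : {set F}) (S0 : (0 < #|S|)%N) (SF : (#|S| < #|F|)%N).
Hypothesis F2 : (2 < #|F|)%N.
Implicit Types (e z : F).

Notation D := (juxtaposition n S).
Notation m := #|Q1 F n :\ branching F n|.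
Notation A2 := (projected_A2 c D).
Notation NO := (nonorthogonal_pairs D).
Notation s := #|F|.
Notation k := #|S|.
Notation P := (@pencil_index_pairs F n).
Notation T := (@twisted_index_pairs F n).

Let q : C := s%:R.
Let kC : C := k%:R.
Let q0 : q != 0. Proof. by rewrite pnatr_eq0 -lt0n card_F_gt0. Qed.
Let k0 : kC != 0. Proof. by rewrite pnatr_eq0 -lt0n. Qed.
Let N0 : (0 < #|design_rows n S|)%N.
Proof. by rewrite card_design_rows muln_gt0 S0 expn_gt0 card_F_gt0. Qed.

Lemma SSD_juxtaposition : is_SSD (k * s ^ n.+1) ((s ^ n.+2 - s) %/ (s - 1)) D.
Proof.
split; [exact: card_design_rows| |exact: balanced_juxtaposition].
rewrite -/(design_cols F n) card_design_cols expnS -(card_normalized F n).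
rewrite mulnDr muln1 addnK mulnCA mulKn //.
by rewrite subn_gt0 (ltn_trans _ F2).
Qed.

Lemma gwp2_juxtaposition :
  gwp c 2 D = (s%:R ^+ n.+2 - s%:R) * (s%:R - k%:R) / (2%:R * k%:R).
Proof.
have := near_constant_gwp2 hc (balanced_juxtaposition n S)
  (near_constant_juxtaposition n S) N0.
move: (gwp c 2 D) => g /=.
rewrite -/(design_cols F n) -/(design_rows n S) card_design_cols card_design_rows.
have h0 : (0 < #|normalized F n|)%N.
  by apply/card_gt0P; exists (@basis_vector F n 1); exact: basis1_normalized.
move: (card_normalized F n); case: #|normalized F n| h0 => // l _ /= E.
have EQ : q ^+ n.+1 = (q - 1) * (l%:R + 1) + 1.
  rewrite -natrX -E natrD natrM natrB ?card_F_gt0 // -/q.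
  by rewrite -[l.+1%:R]natr1.
rewrite !natrM -[l.+1%:R]natr1 !natrX -/q -/kC [q ^+ n.+2]exprS => A.
have Q0 : q ^+ n.+1 != 0 by rewrite expf_neq0.
apply: (@mulIf _ 2%:R); first by rewrite pnatr_eq0.
rewrite mulr_natr {}A; rewrite EQ in Q0 *.
by field; rewrite k0 Q0.
Qed.

Lemma GMA_juxtaposition : GMA_optimal c D.
Proof.
exact: near_constant_GMA_optimal hc (balanced_juxtaposition n S)
  (near_constant_juxtaposition n S) N0.
Qed.

Lemma A2_pencil_index p : p \in P -> A2 p = (q - kC) / kC.
Proof. by rewrite in_set => /andP[_]; apply: A2_pencil. Qed.

Lemma A2_twisted_index (E : {set F}) p : p \in T E ->
  exists2 e, e \in E & A2 p = (twist S e)%:R / (q * kC ^+ 2) - 1.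
Proof. by rewrite in_set => /andP[_]; apply: A2_twisted. Qed.

Lemma index_pair_cases p : p \in column_pairs m ->
  [\/ p \in P, p \in T [set: F] | A2 p = 0].
Proof.
move=> pc; have [h|h|h] := A2_cases hc S0 pc; last exact: Or33.
  by apply: Or31; rewrite in_set pc.
by apply: Or32; rewrite in_set pc.
Qed.

Lemma pencil_A2_neq0 : (q - kC) / kC != 0.
Proof. by rewrite mulf_neq0 ?invr_eq0 // subr_eq0 eqr_nat gtn_eqF. Qed.

Lemma pencil_index_pairs_nonorthogonal : P \subset NO.
Proof.
apply/subsetP => p pP; rewrite (nonorthogonalE hc) // (A2_pencil_index pP) pencil_A2_neq0.
by move: pP; rewrite in_set => /andP[->].
Qed.

Lemma odd_A2_twisted (E : {set F}) p : odd s -> p \in T E -> A2 p = (q - kC) / (kC * q).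
Proof.
move=> os /A2_twisted_index[e _ ->]; rewrite twist_odd // natrD !natrM !natrB ?muln_gt0 ?card_F_gt0 //.
by rewrite natrM -/q -/kC; field; rewrite q0 k0.
Qed.

Lemma even_A2_twisted_le1 (E : {set F}) p : ~~ odd s -> p \in T E -> A2 p <= 1.
Proof.
move=> es /A2_twisted_index[e _ ->]; rewrite lerBlDr ler_pdivrMr; last first.
  by rewrite mulr_gt0 ?exprn_gt0 ?ltr0n ?card_F_gt0.
apply: le_trans (_ : (s * (k ^ 2 * 2))%:R <= _).
  by rewrite ler_nat twist_even_le.
by rewrite !natrM -/q -/kC le_eqVlt; apply/orP; left; apply/eqP; ring.
Qed.

Lemma twisted_index_pairs_split (E : {set F}) p :
  p \in T [set: F] -> p \in T E \/ exists2 e, e \notin E &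
     A2 p = (twist S e)%:R / (q * kC ^+ 2) - 1.
Proof.
rewrite !in_set => /andP[pc] pT; rewrite pc /=.
have [a [d [b [e [dT b0 _ fE gE]]]]] := twisted_pairsP _ _ _ pT.
have [eE|eE] := boolP (e \in E).
  by left; apply/twisted_pairsP; exists a, d, b, e.
right; exists e => //.
have pT' : column_pair p \in twisted_pairs n [set e].
  by apply/twisted_pairsP; exists a, d, b, e; rewrite in_set1.
by have [e'] := A2_twisted hc S0 pT'; rewrite in_set1 => /eqP->.
Qed.

(** The nonorthogonal pairs are pencil pairs or twisted pairs with parameter in E,
    provided that the twist counts outside E are those of orthogonal columns. *)
Lemma nonorthogonal_sub_index_pairs (E : {set F}) :
  (forall e, e \notin E -> (twist S e)%:R / (q * kC ^+ 2) - 1 = 0 :> C) ->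
  NO \subset P :|: T E.
Proof.
move=> E0; apply/subsetP => p; rewrite (nonorthogonalE hc) // => /andP[pc pn0].
rewrite in_setU; case: (index_pair_cases pc) => [->//|/(twisted_index_pairs_split E)|p0].
  case=> [->|[e eE pe]]; first by rewrite orbT.
  by rewrite pe E0 ?eqxx in pn0.
by rewrite p0 eqxx in pn0.
Qed.

Lemma card_index_pairsU (E : {set F}) : #|P :|: T E| = (#|P| + #|T E|)%N.
Proof.
rewrite cardsU (_ : P :&: T E = set0) ?cards0 ?subn0 //.
by apply/eqP; rewrite setI_eq0 disjoint_index_pairs.
Qed.

Lemma not_fully_aliased p : (1 < k)%N -> p \in column_pairs m ->
  ~~ fully_aliased_pair D p.
Proof.
move=> k1 pc; apply/negP.
move=> /(fully_aliased_A2 hc (balanced_juxtaposition n S) N0); rewrite -/q.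
have q1 : q - 1 != 0 by rewrite subr_eq0 (eqr_nat _ _ 1) gtn_eqF // (ltn_trans _ F2).
case: (index_pair_cases pc) => [/A2_pencil_index->|pT|->]; last first.
- by move/eqP; rewrite eq_sym (negPf q1).
- case: (boolP (odd s)) => [os|es].
    rewrite (odd_A2_twisted os pT) => /(congr1 ( *%R^~ (kC * q))).
    rewrite mulfVK ?mulf_neq0 // => E.
    have : (s + k * s)%:R = (k * (s * s) + k)%:R :> C.
      rewrite !natrD !natrM -/q -/kC.
      transitivity ((q - kC) + (kC + kC * q)); first by ring.
      by rewrite E; ring.
    by move/eqP; rewrite eqr_nat => /eqP; nia.
  move=> E; have := even_A2_twisted_le1 es pT; rewrite E lerBlDr -[1 + 1]/(2%:R) ler_nat.
  by rewrite leqNgt F2.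
move=> /(congr1 ( *%R^~ kC)); rewrite mulfVK // => E.
have : s%:R = (s * k)%:R :> C.
  rewrite natrM -/q -/kC; transitivity ((q - kC) + kC); first by ring.
  by rewrite E; ring.
by move/eqP; rewrite eqr_nat => /eqP; nia.
Qed.

Lemma card_pencil_index_pairs_half : #|P| = ((s * (s - 1)) %/ 2)%N.
Proof. by apply: half_of_double; rewrite card_pencil_index_pairs. Qed.

Lemma odd_conclusion : odd s ->
  [/\ #|NO| = ((s * (s ^ n.+2 - s ^ 2 + s - 1)) %/ 2)%N,
      #|[set p in NO | A2 p == (q - kC) / kC]| = ((s * (s - 1)) %/ 2)%N &
      #|[set p in NO | A2 p == (q - kC) / (kC * q)]|
        = ((s * (s ^ n.+2 - s ^ 2)) %/ 2)%N].
Proof.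
move=> os; have A2T p (pT : p \in T [set: F]) := odd_A2_twisted os pT.
have a0 := pencil_A2_neq0.
have b0 : (q - kC) / (kC * q) != 0.
  by move: a0; rewrite !mulf_eq0 !invr_eq0 mulf_eq0 (negPf q0) (negPf k0) !orbF.
have ab : (q - kC) / kC != (q - kC) / (kC * q).
  rewrite invfM mulrA -subr_eq0 -[X in X - _]mulr1 -mulrBr mulf_neq0 //.
  rewrite subr_eq0 eq_sym -(inj_eq (mulIf q0)) mulVf // mul1r.
  by rewrite (eqr_nat _ 1) ltn_eqF // (ltn_trans _ F2).
have NOE : NO = P :|: T [set: F].
  apply/eqP; rewrite eqEsubset nonorthogonal_sub_index_pairs; last by move=> e; rewrite in_setT.
  rewrite subUset pencil_index_pairs_nonorthogonal; apply/subsetP => p pT.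
  rewrite (nonorthogonalE hc) // (A2T p pT) b0 andbT.
  by move: pT; rewrite in_set => /andP[].
have cT : (2 * #|T [set: F]| = s * (s ^ n.+2 - s ^ 2))%N.
  by rewrite card_twisted_index_pairs cardsT.
split.
- rewrite NOE card_index_pairsU; apply: half_of_double.
  rewrite mulnDr card_pencil_index_pairs cT -mulnDr; congr (_ * _)%N.
  by rewrite addnC addnBA ?card_F_gt0.
- rewrite -card_pencil_index_pairs_half; apply: eq_card => p; rewrite in_set NOE in_setU.
  have [pP|pP] := boolP (p \in P); first by rewrite (A2_pencil_index pP) eqxx.
  apply/negP => /= /andP[pT]; rewrite (A2T p pT) eq_sym (negPf ab).
  by [].
- rewrite -(half_of_double cT); apply: eq_card => p; rewrite in_set NOE in_setU.
  have [pT|pT] := boolP (p \in T [set: F]); first by rewrite (A2T p pT) eqxx orbT.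
  by rewrite orbF; apply/negP => /andP[pP]; rewrite (A2_pencil_index pP) (negPf ab).
Qed.

Lemma cardC1_0 : #|[set~ 0 : F]| = (s - 1)%N.
Proof. by rewrite cardsC1 subn1. Qed.

Lemma even_A2_parameter0 e : ~~ odd s -> e \notin [set~ 0] ->
  (twist S e)%:R / (q * kC ^+ 2) - 1 = 0 :> C.
Proof.
move=> es; rewrite in_setC1 negbK => /eqP->; rewrite twist_even0 //.
by rewrite natrM natrX -/q -/kC; field; rewrite q0 k0.
Qed.

Lemma even_conclusion : ~~ odd s ->
  (#|NO| <= ((s - 1) * (s ^ n.+2 - s ^ 2 + s)) %/ 2)%N /\
  exists P : {set 'I_ _ * 'I_ _},
    [/\ P \subset NO, #|P| = ((s * (s - 1)) %/ 2)%N,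
        (forall p, p \in P -> A2 p = (q - kC) / kC),
        (#|NO :\: P| <= ((s - 1) * (s ^ n.+2 - s ^ 2)) %/ 2)%N &
        (forall p, p \in NO :\: P -> A2 p <= 1)].
Proof.
move=> es; have NOs := nonorthogonal_sub_index_pairs (fun e => @even_A2_parameter0 e es).
have cT : (2 * #|T [set~ 0%R]| = (s - 1) * (s ^ n.+2 - s ^ 2))%N.
  by rewrite card_twisted_index_pairs cardC1_0.
split.
  apply: leq_trans (subset_leq_card NOs) _; rewrite card_index_pairsU.
  rewrite leq_eqVlt; apply/orP; left; apply/eqP/half_of_double.
  by rewrite mulnDr card_pencil_index_pairs cT mulnDr addnC [(s * _)%N]mulnC.
have NOP : NO :\: P \subset T [set~ 0].
  by rewrite subDset.
exists P; split; [exact: pencil_index_pairs_nonorthogonal|exact: card_pencil_index_pairs_half|exact: A2_pencil_index| |].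
  by rewrite -(half_of_double cT) subset_leq_card.
by move=> p /(subsetP NOP); exact: even_A2_twisted_le1.
Qed.

(** With S = {z1, z2}, a twisted pair is nonorthogonal if and only if the square
    of its parameter is z1 - z2. *)
Lemma F4_conclusion2 : s = 4%N -> k = 2%N ->
  #|NO| = ((4 ^ n.+2 - 4) %/ 2)%N /\ (forall p, p \in NO -> A2 p = 1).
Proof.
move=> s4 k2; have es : ~~ odd s by rewrite s4.
have qE : q = 4%:R by rewrite /q s4.
have kE : kC = 2%:R by rewrite /kC k2.
have [z1 [z2 [z12 SE]]] : exists z1 z2, z1 != z2 /\ S = [set z1; z2].
  by have /eqP/cards2P[z1 [z2 [? ?]]] := k2; exists z1, z2.
(* squaring twice is the identity, so e0 is the only e with e^2 = z1 - z2 *)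
pose dl := z1 - z2; pose e0 := dl ^+ 2.
have dl0 : dl != 0 by rewrite subr_eq0.
have e00 : e0 != 0 by rewrite expf_neq0.
have e4 e : e ^+ 2 ^+ 2 = e by rewrite -exprM -[RHS](expf_card e) s4.
have two0 : 2%:R = 0 :> F by apply/eqP; rewrite two_eq0_odd_card.
have twE e : e != 0 -> twist S e = (if e == e0 then 32 else 16)%N.
  move=> en0; rewrite twist4 // k2.
  have -> : (e == e0) = (e ^+ 2 == dl).
    apply/eqP/eqP => [->|E]; first by rewrite /e0 e4.
    by rewrite /e0 -E e4.
  have e20 : e ^+ 2 != 0 by rewrite expf_neq0.
  have h : forall z, (z \in S) && (z - e ^+ 2 \in S) = (z \in S) && (e ^+ 2 == dl).
    move=> z; rewrite SE !in_set2; case: (z =P z1) => [->|_] /=.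
      rewrite -subr_eq0 addrAC subrr add0r oppr_eq0 (negPf e20) /=.
      by rewrite subr_eq addrC -subr_eq eq_sym.
    case: (z =P z2) => [->|_] //=.
    rewrite [X in _ || X](_ : _ = false) ?orbF; last first.
      by rewrite -subr_eq0 addrAC subrr add0r oppr_eq0 (negPf e20).
    rewrite subr_eq addrC -subr_eq eq_sym /dl -[z2 - z1]opprB -[RHS](inj_eq oppr_inj).
    congr (_ == _); apply/eqP; rewrite -addr_eq0 -mulr2n -mulr_natl two0.
    by rewrite mul0r.
  have -> : [set z in S | z - e ^+ 2 \in S] = if e ^+ 2 == dl then S else set0.
    apply/setP => z; rewrite in_set h; case: ifP => _; rewrite ?andbT ?andbF //.
    by rewrite in_set0.
  by case: ifP => _; rewrite ?k2 ?cards0.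
have NOE : NO = P :|: T [set e0].
  apply/eqP; rewrite eqEsubset nonorthogonal_sub_index_pairs; last first.
    move=> e; rewrite in_set1 => ee0.
    have [->|en0] := eqVneq e 0; first by apply: even_A2_parameter0; rewrite // in_setC1 eqxx.
    by rewrite twE // (negPf ee0) qE kE; field.
  rewrite subUset pencil_index_pairs_nonorthogonal; apply/subsetP => p pT.
  rewrite (nonorthogonalE hc) //; have [e] := A2_twisted_index pT.
  rewrite in_set1 => /eqP-> ->; rewrite twE // eqxx qE kE.
  move: pT; rewrite in_set => /andP[-> _] /=.
  by rewrite (_ : _ - 1 = 1) ?oner_neq0 //; field.
split; last first.
  move=> p; rewrite NOE in_setU => /orP[/A2_pencil_index->|/A2_twisted_index[e]].
    by rewrite qE kE; field.
  by rewrite in_set1 => /eqP-> ->; rewrite twE // eqxx qE kE; field.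
rewrite NOE card_index_pairsU; apply: half_of_double.
rewrite mulnDr card_pencil_index_pairs card_twisted_index_pairs cards1 s4 mul1n.
have : (4 ^ 2 <= 4 ^ n.+2)%N by rewrite leq_pexp2l.
by move: (4 ^ n.+2)%N => X; rewrite !expnS expn0; lia.
Qed.

Lemma F4_conclusion3 : s = 4%N -> k = 3%N ->
  [/\ #|NO| = (6 + (3 * (4 ^ n.+2 - 16)) %/ 2)%N,
      #|[set p in NO | A2 p == 1 / 3%:R]| = 6%N &
      #|[set p in NO | A2 p == 1 / 9%:R]| = ((3 * (4 ^ n.+2 - 16)) %/ 2)%N].
Proof.
move=> s4 k3; have es : ~~ odd s by rewrite s4.
have qE : q = 4%:R by rewrite /q s4.
have kE : kC = 3%:R by rewrite /kC k3.
have [w SE] : exists w, ~: S = [set w].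
  by apply/cards1P; rewrite cardsCs setCK s4 k3.
have inS z : (z \in S) = (z != w).
  by rewrite -[S]setCK SE in_setC1.
have twE e : e != 0 -> twist S e = 40%N.
  move=> en0; rewrite twist4 // k3.
  have e20 : e ^+ 2 != 0 by rewrite expf_neq0.
  (* both z and z - e^2 must avoid the only point w outside S *)
  have -> : [set z in S | z - e ^+ 2 \in S] = ~: [set w; w + e ^+ 2].
    by apply/setP => z; rewrite in_set !inS in_setC in_set2 negb_or subr_eq.
  rewrite cardsCs setCK s4 cards2 (_ : w != w + e ^+ 2) //.
  by rewrite -subr_eq0 opprD addNKr oppr_eq0.
have A2T p (pT : p \in T [set~ 0]) : A2 p = 1 / 9%:R.
  have [e] := A2_twisted_index pT; rewrite in_setC1 => en0 ->; rewrite twE // qE kE.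
  by field.
have A2P p (pP : p \in P) : A2 p = 1 / 3%:R.
  by rewrite (A2_pencil_index pP) qE kE; field.
have ab : 1 / 3%:R != 1 / 9%:R :> C.
  rewrite -subr_eq0 (_ : _ - _ = 2%:R / 9%:R); last by field.
  by rewrite mulf_neq0 ?invr_eq0 ?pnatr_eq0.
have NOE : NO = P :|: T [set~ 0].
  apply/eqP; rewrite eqEsubset nonorthogonal_sub_index_pairs; last by move=> e; exact: even_A2_parameter0.
  rewrite subUset pencil_index_pairs_nonorthogonal; apply/subsetP => p pT.
  rewrite (nonorthogonalE hc) // A2T // mul1r invr_eq0 pnatr_eq0 andbT.
  by move: pT; rewrite in_set => /andP[].
have cP : #|P| = 6%N by rewrite card_pencil_index_pairs_half s4.
have cT : #|T [set~ 0]| = ((3 * (4 ^ n.+2 - 16)) %/ 2)%N.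
  by apply: half_of_double; rewrite card_twisted_index_pairs cardC1_0 s4.
split.
- by rewrite NOE card_index_pairsU cP cT.
- rewrite -cP; apply: eq_card => p; rewrite in_set NOE in_setU.
  have [pP|pP] := boolP (p \in P); first by rewrite A2P // eqxx.
  by apply/negP => /= /andP[pT]; rewrite A2T // eq_sym (negPf ab).
- rewrite -cT; apply: eq_card => p; rewrite in_set NOE in_setU.
  have [pT|pT] := boolP (p \in T _); first by rewrite A2T // eqxx orbT.
  by rewrite orbF; apply/negP => /andP[pP]; rewrite A2P // (negPf ab).
Qed.

End Conclusions.

Theorem theorem9 (F : finFieldType) (C : numClosedFieldType)
    (c : 'I_(#|F|.-1) -> F -> C) (n k s : nat) (S : {set F})
    (hc : orthonormal_contrasts c)
    (hs : #|F| = s) (hs2 : (2 < s)%N)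
    (hS : #|S| = k) (hk : (1 <= k < s)%N) :
  let D := juxtaposition n S in
  let A2 := projected_A2 c D in
  let NO := nonorthogonal_pairs D in
  [/\ branching F n \in Q1 F n,
      is_SSD (k * s ^ n.+1)%N ((s ^ n.+2 - s) %/ (s - 1))%N D,
      gwp c 2 D
        = (s%:R ^+ n.+2 - s%:R) * (s%:R - k%:R) / (2%:R * k%:R),
      GMA_optimal c D &
      (1 < k)%N ->
        forall p, p \in column_pairs _ -> ~~ fully_aliased_pair D p] /\
  [/\ (* (i) *)
      odd s ->
        [/\ #|NO| = ((s * (s ^ n.+2 - s ^ 2 + s - 1)) %/ 2)%N,
            #|[set p in NO | A2 p == (s%:R - k%:R) / k%:R]|
              = ((s * (s - 1)) %/ 2)%N &
            #|[set p in NO | A2 p == (s%:R - k%:R) / (k%:R * s%:R)]|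
              = ((s * (s ^ n.+2 - s ^ 2)) %/ 2)%N],
      (* (ii) *)
      ~~ odd s ->
        (#|NO| <= ((s - 1) * (s ^ n.+2 - s ^ 2 + s)) %/ 2)%N /\
        exists P : {set 'I_ _ * 'I_ _},
          [/\ P \subset NO,
              #|P| = ((s * (s - 1)) %/ 2)%N,
              (forall p, p \in P -> A2 p = (s%:R - k%:R) / k%:R),
              (#|NO :\: P| <= ((s - 1) * (s ^ n.+2 - s ^ 2)) %/ 2)%N &
              (forall p, p \in NO :\: P -> A2 p <= 1)],
      (* (iii), k = 2 *)
      s = 4%N -> k = 2%N ->
        #|NO| = ((4 ^ n.+2 - 4) %/ 2)%N /\
        (forall p, p \in NO -> A2 p = 1) &
      (* (iii), k = 3 *)
      s = 4%N -> k = 3%N ->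
        [/\ #|NO| = (6 + (3 * (4 ^ n.+2 - 16)) %/ 2)%N,
            #|[set p in NO | A2 p == 1 / 3%:R]| = 6%N &
            #|[set p in NO | A2 p == 1 / 9%:R]|
              = ((3 * (4 ^ n.+2 - 16)) %/ 2)%N]].
Proof.
subst s k; case/andP: hk => k1 ks D A2 NO.
split; split.
- exact: branching_Q1.
- exact: SSD_juxtaposition.
- exact: gwp2_juxtaposition.
- exact: GMA_juxtaposition.
- by move=> k2 p; apply: (not_fully_aliased hc).
- exact: odd_conclusion.
- exact: even_conclusion.
- by move=> s4 k2; apply: F4_conclusion2.
- by move=> s4 k3; apply: F4_conclusion3.
Qed.
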